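(* Let $A \subseteq \mathbb{R}^d$ be such that $D(A) = \overline{D}(A)$, and let $k$ be an integer with $0 \le k \le d$. For almost every projection $P : \mathbb{R}^d \to \mathbb{R}^d$ with range $\mathbb{R}^k \times \{0\}^{d-k}$, $$\overline{D}(PA) = \min\big(k, \overline{D}(A)\big)$$ and, if $A$ is counting regular and mass regular and $\overline{D}(A) \neq k$, then $\overline{d}^{\,\min(k,\overline{D}(A))}(PA) > 0$ for almost every such $P$.
   Context: A cube in $\mathbb{R}^d$ is a set $C = \prod_{i=1}^d [a_i, a_i+\ell)$ with $a \in \mathbb{R}^d$, $\ell>0$; its side length is $\|C\| = \ell$. For $A \subseteq \mathbb{R}^d$, $\lfloor A \rfloor \subseteq \mathbb{Z}^d$ is the set of elements of $A$ rounded down in each coordinate. For $\alpha \ge 0$, the $\alpha$-counting measure and $\alpha$-mass measure of $A$ are $$d^{\alpha}(A) = \limsup_{\|C\|\to\infty} \frac{|\lfloor A \rfloor \cap C|}{\|C\|^\alpha} := \lim_{\ell\to\infty} \sup_{\|C\| \ge \ell} \frac{|\lfloor A \rfloor \cap C|}{\|C\|^\alpha}, \qquad \overline{d}^{\,\alpha}(A) = \limsup_{\ell\to\infty} \frac{|\lfloor A \rfloor \cap [-\ell,\ell)^d|}{(2\ell)^\alpha},$$ the first supremum being over cubes $C \subseteq \mathbb{R}^d$. The counting dimension and (upper) mass dimension are $D(A) = \inf\{\alpha \ge 0 \mid d^\alpha(A) = 0\}$ and $\overline{D}(A) = \inf\{\alpha \ge 0 \mid \overline{d}^{\,\alpha}(A)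 = 0\}$. The set $A$ is counting regular if $0 < d^{D(A)}(A) < \infty$ and mass regular if $0 < \overline{d}^{\,\overline{D}(A)}(A) < \infty$. A projection of $\mathbb{R}^d$ is a linear map $P$ with $P^2 = P$ (not necessarily orthogonal). Let $G(d,d-k)$ be the Grassmannian of $(d-k)$-dimensional linear subspaces of $\mathbb{R}^d$ and $\gamma_{d,d-k}$ the unique $O(d)$-invariant Borel probability measure on it. A projection $P$ with range $R = \mathbb{R}^k\times\{0\}^{d-k}$ is determined by its null space, which belongs to $\{V \in G(d,d-k) \mid V \cap R = \{0\}\}$, an open subset of full $\gamma_{d,d-k}$-measure; every element of this set arises. ''Almost every projection with range $R$'' means: for all such projections except those whose null spaces lie in a $\gamma_{d,d-k}$-null set. *)

(* Defs.v *)
From HB Require Import structures.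
From mathcomp Require Import all_boot all_order all_algebra.
From mathcomp Require Import all_classical all_reals all_analysis.
Set Implicit Arguments.
Unset Strict Implicit.
Unset Printing Implicit Defensive.
Import Order.TTheory GRing.Theory Num.Theory.
Import numFieldNormedType.Exports.
Local Open Scope classical_set_scope.
Local Open Scope ring_scope.

(* Vectors of R^d are row vectors 'rV[R]_d. *)

Section Counting.
Context {R : realType} {d : nat}.
Implicit Types (A : set 'rV[R]_d) (alpha : R).

Definition cube (a : 'rV[R]_d) (l : R) : set 'rV[R]_d :=
  [set x | forall i, a ord0 i <= x ord0 i < a ord0 i + l].

Definition floor_set A : set 'rV[int]_d := map_mx Num.floor @` A.

(* The set counted is always finite; counting takes values in \bar R only
   because that is where the limits superior below are computed. *)
Definition lattice_count A (C : set 'rV[R]_d) : \bar R :=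
  counting (floor_set A `&` [set z | C (map_mx intr z)]).

Definition cube_ratio alpha A (a : 'rV[R]_d) (l : R) : \bar R :=
  (lattice_count A (cube a l) * ((l `^ alpha)^-1)%:E)%E.

(* The function of l is nonincreasing, so the limit exists in \bar R. *)
Definition counting_measure alpha A : \bar R :=
  lim (ereal_sup [set y | exists a s,
         [/\ 0 < s, l <= s & y = cube_ratio alpha A a s]] @[l --> +oo]).

Definition mass_measure alpha A : \bar R :=
  limf_esup (fun l : R => cube_ratio alpha A (const_mx (- l)) (2 * l)) +oo.

(* Both sets are nonempty (they contain every alpha > d) and bounded below
   by 0, so the real-valued infimum is the genuine one. *)
Definition counting_dim A : R :=
  inf [set alpha | 0 <= alpha /\ counting_measure alpha A = 0%E].

Definition mass_dim A : R :=
  inf [set alpha | 0 <= alpha /\ mass_measure alpha A = 0%E].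

Definition counting_regular A : Prop :=
  (0 < counting_measure (counting_dim A) A < +oo)%E.

Definition mass_regular A : Prop :=
  (0 < mass_measure (mass_dim A) A < +oo)%E.

End Counting.

(* The bound m <= d is an argument of the type because measurable types have
   to be inhabited. *)
Record grassmannian (R : realType) (d m : nat) (hm : (m <= d)%N) :=
  Grassmannian { subspace_of :> {vspace 'rV[R]_d} ; _ : \dim subspace_of == m }.
Arguments grassmannian R {d m} hm.
Arguments Grassmannian {R d m hm}.
Arguments subspace_of {R d m hm}.

Section Grassmannian.
Context {R : realType} {d m : nat} {hm : (m <= d)%N}.
Local Notation G := (grassmannian R hm).

HB.instance Definition _ := [isSub for @subspace_of R d m hm].
HB.instance Definition _ := [Choice of G by <:].

Lemma grassmannian_inhabited : exists V : {vspace 'rV[R]_d}, \dim V == m.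
Proof.
exists <<take m (vbasis (fullv : {vspace 'rV[R]_d}))>>%VS.
have /basis_free := vbasisP (fullv : {vspace 'rV[R]_d}).
rewrite -[X in free X](cat_take_drop m) => /catl_free; rewrite /free => /eqP ->.
by rewrite size_takel // size_tuple dimvf dim_matrix mul1r.
Qed.

HB.instance Definition _ := isPointed.Build G
  (Grassmannian (xchoose grassmannian_inhabited)
                (xchooseP grassmannian_inhabited)).

Definition rowspan (M : 'M[R]_(m, d)) : {vspace 'rV[R]_d} :=
  <<[seq row i M | i : 'I_m]>>%VS.

(* Quotient topology under M |-> rowspan M from the space of m x d matrices of
   rank m: U is open when its preimage is open in that subspace of the
   matrices. A matrix M has rank m exactly when rowspan M is the underlying
   subspace of some element of G. *)
Definition grassmannian_open (U : set G) : Prop :=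
  forall (M : 'M[R]_(m, d)) (V : G), U V -> subspace_of V = rowspan M ->
  \forall M' \near M, forall V' : G, subspace_of V' = rowspan M' -> U V'.

Lemma grassmannian_openT : grassmannian_open setT.
Proof. by move=> M V _ _; near=> M'. Unshelve. all: by end_near. Qed.

Lemma grassmannian_openI : setI_closed grassmannian_open.
Proof.
move=> U W oU oW M V [UV WV] VM.
apply: filterS2 (oU M V UV VM) (oW M V WV VM) => M' UM' WM' V' V'M'.
by split; [exact: UM' | exact: WM'].
Qed.

Lemma grassmannian_open_bigU (I : Type) (f : I -> set G) :
  (forall i, grassmannian_open (f i)) -> grassmannian_open (\bigcup_i f i).
Proof.
move=> of_ M V [i _ fV] VM; apply: filterS (of_ i M V fV VM) => M' fM' V' V'M'.
by exists i => //; exact: fM'.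
Qed.

HB.instance Definition _ := isOpenTopological.Build G
  grassmannian_openT grassmannian_openI grassmannian_open_bigU.

End Grassmannian.

Notation borel_grassmannian R hm :=
  (g_sigma_algebraType (@open (grassmannian R hm))).

(* An orthogonal matrix g acts on row vectors by x |-> x *m g. These maps form
   the group O(d); the set below is the image of B under g. There is exactly one
   invariant Borel probability measure on the Grassmannian. *)
Definition orthogonal_invariant (R : realType) (d m : nat) (hm : (m <= d)%N)
    (gamma : probability (borel_grassmannian R hm) R) : Prop :=
  forall (g : 'M[R]_d) (B : set (borel_grassmannian R hm)),
    g *m g^T = 1%:M -> measurable B ->
    gamma [set V | exists2 W, B W &
                   subspace_of V = (linfun (mulmxr g : 'rV_d -> 'rV_d) @: W)%VS]
    = gamma B.

Definition projection_onto_coords (R : realType) (d k : nat)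
    (P : 'End('rV[R]_d)) : Prop :=
  (P \o P)%VF = P /\
  range P = [set x : 'rV[R]_d | forall i : 'I_d, (k <= i)%N -> x ord0 i = 0].

(* Q holds for all projections P with range R^k x {0}^(d-k) except those whose
   null space lies in a gamma-null set. *)
Definition ae_projection (R : realType) (d k : nat)
    (gamma : probability (borel_grassmannian R (leq_subr k d)) R)
    (Q : 'End('rV[R]_d) -> Prop) : Prop :=
  {ae gamma, forall V : grassmannian R (leq_subr k d),
   forall P : 'End('rV[R]_d),
     projection_onto_coords k P -> lker P = V -> Q P}.

(* Main.v *)
Require Import Defs.
From HB Require Import structures.
From mathcomp Require Import all_boot all_order all_algebra.
From mathcomp Require Import all_classical all_reals all_analysis.
From mathcomp Require Import measurable_realfun.
From mathcomp Require Import ring lra zify.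
Set Implicit Arguments.
Unset Strict Implicit.
Unset Printing Implicit Defensive.
Import Order.TTheory GRing.Theory Num.Theory.
Import numFieldNormedType.Exports.
Local Open Scope classical_set_scope.
Local Open Scope ring_scope.

(** The null space V of a projection P with the prescribed range is a random
subspace of dimension d - k, and z - P z lies in V.  So P z can be short only
if V passes near z, and everything rests on one estimate (near_prob_le): a
random V passes within distance c of a point z with probability at most a
constant times (c / |z|) ^ k.  Invariance under rotations replaces the
integration over the orthogonal group that usually proves this.  By invariance
the probability depends only on |z|, and it decreases with |z|; hence it is at
most its average over the points of a cubic grid of side comparable to |z|, and
a fixed V passes near only about |z| ^ (d - k) of these |z| ^ d points
(card_grid_near), because V is a graph with bounded slopes over d - k suitable
coordinates (dominating_coords).

Lower bound (ae_mass_measure_gt0).  Choose lengths l for which the box of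
half-side l contains many points of A.  Two of these points x and y are
identified after projecting and rounding with probability at most about
|x - y| ^ - k.  If all cubes of side s contain at most about s ^ beta points of
A, which is what the counting measure controls, then the sum of these
probabilities over y is at most about l ^ max(0, beta - k), provided that beta
differs from k (riesz_energy_le).  Hence the expected
number of identified pairs, suitably normalized, stays bounded along the chosen
lengths.  By Fatou's lemma (ae_bounded_infinitely_often) it stays bounded
infinitely often for almost every V, and by the Cauchy--Schwarz inequality
(values_lower) the projected box then contains many lattice points.

Upper bound (ae_mass_measure_eq0).  When the dimension of A is at least k there
is nothing to do, as the image lies in a space of dimension k.  Otherwise the
danger is that remote points of A project close to the origin.  A point at
distance about 2 ^ j, with j > i, projects into the ball of radius 2 ^ i with probability at
most about 2 ^ (k (i - j)); when A has mass exponent alpha < k these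
probabilities, weighted by 2 ^ (- i alpha'), have a finite sum as soon as
alpha < alpha' < k.  So for almost every V at most about 2 ^ (i alpha') of
the remote points project into the ball of radius 2 ^ i, and there are at most
about 2 ^ (i alpha) points that are not remote.

The equality of the two dimensions of A enters only in that the lower bound
needs lower bounds on boxes and upper bounds on all cubes with nearly the same
exponent. *)

(** * Counting the values of a map on a finite sequence *)

Section Fibers.
Variables (T U : eqType) (f : T -> U) (X : seq T).

Definition values : seq U := undup (map f X).

Definition fiber_size (u : U) : nat := count (fun x => f x == u) X.

Lemma size_sum_fibers : size X = (\sum_(u <- values) fiber_size u)%N.
Proof.
rewrite -sum1_size.
under eq_bigr => x _ do rewrite -[1%N]/(nat_of_bool true).
rewrite (eq_big_seq (fun x => \sum_(u <- values) (f x == u))%N); last first.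
  move=> x xX; rewrite -big_mkcond/= sum1_count.
  under eq_count do rewrite eq_sym.
  by rewrite count_uniq_mem ?undup_uniq// mem_undup map_f.
by rewrite exchange_big; apply: eq_bigr => u _; rewrite -big_mkcond/= sum1_count.
Qed.

Lemma fibers_sum_sqr : (\sum_(x <- X) \sum_(y <- X) (f x == f y) =
  \sum_(u <- values) fiber_size u * fiber_size u)%N.
Proof.
rewrite (eq_big_seq (fun x => \sum_(u <- values) (f x == u) * fiber_size u)%N).
  rewrite exchange_big; apply: eq_bigr => u _.
  by rewrite -big_distrl/= -big_mkcond/= sum1_count.
move=> x xX; rewrite (bigD1_seq (f x)) ?undup_uniq ?mem_undup ?map_f//=.
rewrite eqxx mul1n [X in (_ + X)%N]big1 => [|u]; last first.
  by rewrite [f x == u]eq_sym => /negPf ->.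
by rewrite addn0 -big_mkcond/= sum1_count; apply: eq_count => y/=; rewrite eq_sym.
Qed.

(** Cauchy--Schwarz inequality for the sizes of the fibers. *)
Lemma values_lower (R : realFieldType) :
  (size X)%:R ^+ 2 <= (size values)%:R *
    \sum_(x <- X) \sum_(y <- X) (f x == f y)%:R :> R.
Proof.
have -> : \sum_(x <- X) \sum_(y <- X) (f x == f y)%:R =
    \sum_(u <- values) (fiber_size u)%:R ^+ 2 :> R.
  under eq_bigr do rewrite -natr_sum; rewrite -natr_sum fibers_sum_sqr natr_sum.
  by apply: eq_bigr => u _; rewrite natrM expr2.
set N : R := (size values)%:R; set S : R := (size X)%:R.
have ES : S = \sum_(u <- values) (fiber_size u)%:R.
  by rewrite /S size_sum_fibers natr_sum.
have [N0|N0] := eqVneq N 0.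
  move: N0 ES; rewrite /N => /eqP; rewrite pnatr_eq0 size_eq0 => /eqP ->.
  by rewrite big_nil => ->; rewrite expr0n mul0r.
have Npos : 0 < N by rewrite lt_def N0 ler0n.
pose Q : R := \sum_(u <- values) (fiber_size u)%:R ^+ 2.
have : 0 <= \sum_(u <- values) (N * (fiber_size u)%:R - S) ^+ 2.
  by apply: sumr_ge0 => u _; exact: sqr_ge0.
have -> : \sum_(u <- values) (N * (fiber_size u)%:R - S) ^+ 2 =
    N * (N * Q - S ^+ 2).
  transitivity (N ^+ 2 * Q - 2 * N * S * S + N * S ^+ 2); last by ring.
  have -> : N * S ^+ 2 = \sum_(u <- values) S ^+ 2.
    rewrite /N -sum1_size natr_sum mulr_suml.
    by apply: eq_bigr => u _; rewrite mul1r.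
  have -> : 2 * N * S * S = \sum_(u <- values) 2 * N * S * (fiber_size u)%:R.
    by rewrite -mulr_sumr -ES.
  rewrite /Q mulr_sumr -sumrB -big_split.
  by apply: eq_bigr => u _ /=; ring.
by rewrite pmulr_rge0// subr_ge0.
Qed.
End Fibers.

(** * Integer vectors *)

Section IntegerVectors.
Variable d : nat.
Implicit Types (X : seq 'rV[int]_d).

Lemma size_le_box (k n : nat) (c : 'rV[int]_d) X : uniq X ->
  (forall z, z \in X -> forall i, c ord0 i <= z ord0 i <= c ord0 i + n%:Z) ->
  (forall z, z \in X -> forall i : 'I_d, (k <= i)%N -> z ord0 i = 0) ->
  (size X <= n.+1 ^ k)%N.
Proof.
move=> uX Xbox X0.
pose g (f : {ffun 'I_k -> 'I_n.+1}) : 'rV[int]_d :=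
  \row_i if insub (i : nat) is Some j then c ord0 i + (f j)%:Z else 0.
suff : (size X <= size (codom g))%N by rewrite size_codom card_ffun !card_ord.
apply: uniq_leq_size => // z zX; apply/codomP.
pose h (j : nat) : nat :=
  if insub j is Some i then `|z ord0 i - c ord0 i|%N else 0%N.
exists [ffun j : 'I_k => inord (h j)].
apply/rowP => i; rewrite mxE; case: insubP => [j _ ji|]; last first.
  by rewrite -leqNgt; exact: X0.
rewrite ffunE /h ji valK -[z 0 i]/(z ord0 i).
move: (Xbox z zX i); move: (z ord0 i) (c ord0 i) => u v uv.
by rewrite inordK; lia.
Qed.

(** A fiber of bounded diameter lies in a box of bounded side, so f loses only a
bounded factor in counting. *)
Lemma size_le_values (T : eqType) (f : 'rV[int]_d -> T) (K : nat) X : uniq X ->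
  (forall x y, x \in X -> y \in X -> f x = f y ->
     forall i, `|x ord0 i - y ord0 i| <= K%:Z) ->
  (size X <= size (values f X) * K.*2.+1 ^ d)%N.
Proof.
move=> uX Kf; rewrite (size_sum_fibers f X) -[size (values f X)]sum1_size.
rewrite big_distrl/=.
apply: leq_sum => u _; rewrite mul1n /fiber_size -size_filter.
have [->|[z zF]] : [seq x <- X | f x == u] = [::] \/
    exists z, z \in [seq x <- X | f x == u].
- by case: [seq _ <- _ | _] => [|z s]; [left|right; exists z; rewrite mem_head].
- by [].
have := zF; rewrite mem_filter => /andP[/eqP fz zX].
apply: (@size_le_box d K.*2 (z - const_mx K%:Z)); first exact: filter_uniq.
  move=> x; rewrite mem_filter => /andP[/eqP fx xX] i; rewrite !mxE.
  move: (Kf x z xX zX (etrans fx (esym fz)) i).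
  by move: (x ord0 i) (z ord0 i) => v w; lia.
by move=> x _ i; rewrite leqNgt ltn_ord.
Qed.

Definition int_norm (z : 'rV[int]_d) : nat := (\max_i `|z ord0 i|)%N.

Lemma int_norm_le (z : 'rV[int]_d) (n : nat) :
  (int_norm z <= n)%N <-> forall i, `|z ord0 i| <= n%:Z.
Proof.
split=> [zn i|zn].
  have := leq_trans (leq_bigmax (F := fun i => `|z ord0 i|%N) i) zn.
  by rewrite -lez_nat abszE.
by apply/bigmax_leqP => i _; rewrite -lez_nat abszE; exact: zn.
Qed.

Lemma int_norm_coord (z : 'rV[int]_d) :
  int_norm z = 0%N \/ exists i, int_norm z = `|z ord0 i|%N.
Proof.
have [-> | [i]] : (int_norm z = 0)%N \/ exists i, (0 < `|z ord0 i|)%N.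
  case: (posnP (int_norm z)) => [|z0]; first by left.
  right; apply: contrapT => /forallNP no; move: z0; rewrite lt0n => /negP; apply.
  by rewrite -leqn0; apply/bigmax_leqP => i _; rewrite leqNgt; apply/negP/no.
- by left.
move=> _; right; have I : (0 < #|'I_d|)%N by apply/card_gt0P; exists i.
rewrite /int_norm.
by have [j ->] := @bigop.eq_bigmax _ (fun i : 'I_d => `|z ord0 i|%N) I; exists j.
Qed.

End IntegerVectors.

(** * Dyadic and geometric sums *)

(** In the applications j x is the dyadic scale of a distance and t is a negative
power of 2, so that a bound on the number of points at each distance becomes a
bound on a sum of negative powers of distances. *)
Lemma dyadic_sum (R : realFieldType) (T : eqType) (X : seq T) (j : T -> nat)
    (n : nat) (B b t : R) : 0 <= t ->
  (forall i, (count (fun x => j x == i) X)%:R <= B * b ^+ i) ->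
  (forall x, x \in X -> (j x < n)%N) ->
  \sum_(x <- X) t ^+ j x <= B * \sum_(i < n) (b * t) ^+ i.
Proof.
move=> t0 cB jn.
rewrite (eq_big_seq (fun x => \sum_(i < n) (j x == i)%:R * t ^+ i)); last first.
  move=> x xX; rewrite (bigD1 (Ordinal (jn x xX)))//= eqxx mul1r big1 ?addr0// => i.
  by rewrite -val_eqE/= eq_sym => /negPf ->; rewrite mul0r.
rewrite exchange_big mulr_sumr; apply: ler_sum => i _.
rewrite -mulr_suml exprMn mulrA ler_wpM2r ?exprn_ge0//.
by rewrite -natr_sum -big_mkcond/= sum1_count.
Qed.

(** The largest term of a geometric sum dominates it, up to a constant. *)
Lemma geometric_sum_le (R : realFieldType) (q : R) : 0 <= q -> q != 1 ->
  exists2 C, 0 < C & forall n, \sum_(i < n) q ^+ i <= C * Num.max 1 q ^+ n.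
Proof.
move=> q0 q1; have q1' : q - 1 != 0 by rewrite subr_eq0.
exists `|q - 1|^-1 => [|n]; first by rewrite invr_gt0 normr_gt0.
rewrite mulrC ler_pdivlMr ?normr_gt0// -[X in X * _]ger0_norm; last first.
  by apply: sumr_ge0 => i _; exact: exprn_ge0.
rewrite -normrM mulrC -subrX1; have [q_lt1|q_ge1] := ltP 1 q.
  have := exprn_ege1 n (ltW q_lt1); rewrite ler_norml; lra.
have := exprn_ile1 n q0 q_ge1; have := exprn_ge0 n q0.
by rewrite expr1n ler_norml; lra.
Qed.

(** * Euclidean geometry of row vectors *)

Section Euclidean.
Variables (R : realType) (d : nat).
Implicit Types (x y z v w : 'rV[R]_d) (g : 'M[R]_d).

Definition sqnorm x : R := \sum_i x ord0 i ^+ 2.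

Lemma mulmx_tr_sqnorm x : x *m x^T = (sqnorm x)%:M.
Proof.
apply/rowP => i; rewrite ord1 !mxE eqxx mulr1n.
by apply: eq_bigr => j _; rewrite mxE expr2.
Qed.

Lemma sqnorm_ge0 x : 0 <= sqnorm x.
Proof. by apply: sumr_ge0 => i _; exact: sqr_ge0. Qed.

Lemma sqnorm_eq0 x : (sqnorm x == 0) = (x == 0).
Proof.
apply/idP/eqP => [|->]; last first.
  by rewrite /sqnorm big1// => i _; rewrite mxE expr0n.
rewrite psumr_eq0 => [|i _]; last exact: sqr_ge0.
move=> /allP x0; apply/rowP => i; rewrite mxE.
by apply/eqP; rewrite -sqrf_eq0; exact: (implyP (x0 i (mem_index_enum _))).
Qed.

Lemma sqnormZ a x : sqnorm (a *: x) = a ^+ 2 * sqnorm x.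
Proof. by rewrite mulr_sumr; apply: eq_bigr => i _; rewrite mxE exprMn. Qed.

Lemma sqr_coord_le x i : x ord0 i ^+ 2 <= sqnorm x.
Proof.
by rewrite /sqnorm (bigD1 i)//= lerDl sumr_ge0// => j _; exact: sqr_ge0.
Qed.

Lemma sqnorm_le (r : R) x : (forall i, `|x ord0 i| <= r) -> sqnorm x <= d%:R * r ^+ 2.
Proof.
move=> xr; rewrite -[d in d%:R]card_ord -sum1_card natr_sum mulr_suml.
apply: ler_sum => i _; rewrite mul1r -real_normK ?num_real//.
by rewrite lerXn2r ?nnegrE//; exact: le_trans (xr i).
Qed.

Lemma sqnorm_orthogonal g x : g *m g^T = 1%:M -> sqnorm (x *m g) = sqnorm x.
Proof.
move=> gg; have : (x *m g) *m (x *m g)^T = x *m x^T.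
  by rewrite trmx_mul mulmxA -(mulmxA x) gg mulmx1.
by rewrite !mulmx_tr_sqnorm => /rowP/(_ ord0); rewrite !mxE eqxx.
Qed.

(** For x and y of the same norm, the reflection in the hyperplane orthogonal to
x - y exchanges x and y. *)
Lemma orthogonal_transitive x y : sqnorm x = sqnorm y ->
  exists g, g *m g^T = 1%:M /\ x *m g = y.
Proof.
move=> xy; have [->|neq] := eqVneq x y.
  by exists 1%:M; rewrite trmx1 !mulmx1.
pose w := x - y; have w0 : sqnorm w != 0 by rewrite sqnorm_eq0 subr_eq0.
pose c : R := 2 / sqnorm w; pose W := w^T *m w.
have WT : W^T = W by rewrite trmx_mul trmxK.
have WW : W *m W = sqnorm w *: W.
  by rewrite /W mulmxA -(mulmxA w^T) mulmx_tr_sqnorm mul_mx_scalar -scalemxAl.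
have cw : c * sqnorm w = 2 by rewrite divfK.
have gT : (1%:M - c *: W)^T = 1%:M - c *: W.
  by rewrite raddfB/= trmx1 linearZ/= WT.
exists (1%:M - c *: W); split.
  rewrite gT mulmxBl mul1mx mulmxBr mulmx1 -scalemxAl -scalemxAr WW !scalerA.
  rewrite -mulrA cw mulrDr mulr1 scalerDl.
  rewrite [X in _ - X](_ : _ = - (c *: W)) ?opprK ?subrK//.
  by rewrite opprD addrA subrr sub0r.
have xw : 2 * (x *m w^T) ord0 ord0 = sqnorm w.
  rewrite /w /sqnorm !mxE -[RHS]subr0 -[X in _ = _ - X](subrr (sqnorm x)).
  rewrite {1}xy /sqnorm -!sumrB mulr_sumr; apply: eq_bigr => i _.
  by rewrite !mxE; ring.
rewrite mulmxBr mulmx1 -scalemxAr mulmxA [x *m w^T]mx11_scalar mul_scalar_mx.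
rewrite scalerA [c * _](_ : _ = 1); first by rewrite scale1r /w opprB addrC subrK.
by rewrite /c mulrAC xw divff.
Qed.

Lemma endo_bounded (P : 'End('rV[R]_d)) : exists2 K : R, 0 <= K &
  forall x r, (forall i, `|x ord0 i| <= r) -> forall i, `|P x ord0 i| <= K * r.
Proof.
pose K := \sum_j \sum_i `|P (delta_mx ord0 j) ord0 i|.
exists K => [|x r xr i]; first by do 2 (apply: sumr_ge0 => ? _).
rewrite [x in P x]row_sum_delta linear_sum summxE mulr_suml.
apply: le_trans (ler_norm_sum _ _ _) _; apply: ler_sum => j _.
rewrite linearZ/= mxE normrM mulrC; apply: ler_pM => //.
by rewrite (bigD1 i)//= lerDl sumr_ge0.
Qed.

(** Take the coordinates of a maximal minor of a basis of V.  By Cramer's rule V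
is a graph over them whose slopes are quotients of minors by the maximal one,
hence at most 1 in absolute value. *)
Lemma dominating_coords (m : nat) (V : {vspace 'rV[R]_d}) : \dim V = m ->
  exists f : 'I_m -> 'I_d, forall v, v \in V ->
    forall j, `|v ord0 j| <= \sum_i `|v ord0 (f i)|.
Proof.
move=> dimV; subst m; set m := \dim V.
pose N : 'M[R]_(m, d) := \matrix_(i, j) (vbasis V)`_i ord0 j.
have rowN i : row i N = (vbasis V)`_i by apply/rowP => j; rewrite !mxE.
have freeN : row_free N.
  apply: inj_row_free => u uN; apply/rowP => i; rewrite mxE.
  apply: (freeP (basis_free (vbasisP V)) (fun i => u ord0 i)).
  rewrite -[RHS]uN mulmx_sum_row; apply: eq_bigr => j _; rewrite rowN.
  by congr (_ *: _).
pose D (f : {ffun 'I_m -> 'I_d}) := `|\det (colsub f N)|.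
have fullN : row_full N^T by rewrite /row_full mxrank_tr.
pose f0 := fullrankfun fullN.
have Df0 : 0 < D f0.
  rewrite normr_gt0 -unitfE -unitmxE -unitmx_tr.
  have := fullrowsub_unit fullN; congr (_ \in unitmx).
  by apply/matrixP => i j; rewrite !mxE.
case: (arg_maxP D (isT : predT [ffun i => f0 i])) => f _ fmax.
have Df : 0 < D f by exact: lt_le_trans Df0 (fmax _ isT).
exists f => v vV j.
pose B := colsub f N; pose u := \row_i coord (vbasis V) i v.
have Bunit : B \in unitmx by rewrite unitmxE unitfE -normr_gt0.
have vE : v = u *m N.
  rewrite [LHS](coord_vbasis vV) mulmx_sum_row; apply: eq_bigr => i _.
  by rewrite rowN mxE.
have uE : u = (u *m B) *m invmx B by rewrite mulmxK.
have uB i : (u *m B) ord0 i = v ord0 (f i).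
  by rewrite vE [LHS]mxE [RHS]mxE; apply: eq_bigr => l _; rewrite [B l i]mxE.
have -> : v ord0 j = \sum_i v ord0 (f i) * (invmx B *m N) i j.
  rewrite [in LHS]vE {1}uE -(mulmxA (u *m B)) [LHS]mxE; apply: eq_bigr => i _.
  by congr (_ * _); exact: uB.
apply: le_trans (ler_norm_sum _ _ _) _; apply: ler_sum => i _.
rewrite normrM ler_piMr//.
pose f' := [ffun l => if l == i then j else f l].
have -> : (invmx B *m N) i j = (\det B)^-1 * \det (colsub f' N).
  rewrite /invmx Bunit -scalemxAl mxE; congr (_ * _).
  rewrite (expand_det_col _ i) mxE; apply: eq_bigr => l _.
  rewrite !mxE ffunE eqxx mulrC; congr (_ * _).
  rewrite /cofactor; congr (_ * \det _); apply/matrixP => a b.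
  by rewrite !mxE ffunE eq_sym (negPf (neq_lift _ _)).
rewrite normrM normfV ler_pdivrMl// mulr1.
exact: (fmax f' isT).
Qed.

End Euclidean.

(** * Sums of weighted events, and Fatou's lemma *)

Section WeightedEvents.
Context (disp : measure_display) (T : measurableType disp) (R : realType).
Variable mu : probability T R.

Definition weighted_events (I : Type) (s : seq I) (w : I -> R) (E : I -> set T)
  (x : T) : R := \sum_(i <- s) w i * \1_(E i) x.

Lemma weighted_events_ge0 (I : Type) (s : seq I) (w : I -> R) (E : I -> set T) x :
  (forall i, 0 <= w i) -> 0 <= weighted_events s w E x.
Proof.
by move=> w0; apply: sumr_ge0 => i _; rewrite mulr_ge0// indicE ler0n.
Qed.

Lemma measurable_weighted_events (I : Type) (s : seq I) (w : I -> R) (E : I -> set T) :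
  (forall i, measurable (E i)) -> measurable_fun setT (weighted_events s w E).
Proof.
move=> mE; apply: measurable_sum => i.
by apply: measurable_funM => //; exact: measurable_indic.
Qed.

Lemma integral_weighted_events (I : Type) (s : seq I) (w : I -> R) (E : I -> set T) :
  (forall i, 0 <= w i) -> (forall i, measurable (E i)) ->
  (\int[mu]_x (weighted_events s w E x)%:E)%E =
  (\sum_(i <- s) w i * fine (mu (E i)))%:E.
Proof.
move=> w0 mE; under eq_integral do rewrite /weighted_events -sumEFin.
rewrite ge0_integral_sum//; last 2 first.
- by move=> i; apply/measurable_EFinP; apply: measurable_funM.
- by move=> i x _; rewrite lee_fin mulr_ge0// indicE ler0n.
rewrite -sumEFin; apply: eq_bigr => i _.
under eq_integral do rewrite EFinM.
rewrite ge0_integralZl// ?lee_fin//; last first.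
- by apply/measurable_EFinP; exact: measurable_indic.
by rewrite integral_indic// setIT EFinM fineK// fin_num_measure.
Qed.

(** By Fatou's lemma the lower limit of f has a finite integral, so it is finite
almost everywhere.  For a nondecreasing f the conclusion is boundedness, which
makes this lemma serve as a Borel--Cantelli lemma too. *)
Lemma ae_bounded_infinitely_often (f : nat -> T -> R) (K : R) :
  (forall n, measurable_fun setT (f n)) -> (forall n x, 0 <= f n x) ->
  (forall n, (\int[mu]_x (f n x)%:E <= K%:E)%E) ->
  {ae mu, forall x, exists M, forall N, exists2 n, (N <= n)%N & f n x <= M}.
Proof.
move=> mf f0 fK.
have mfE n : measurable_fun setT (EFin \o f n) by apply/measurable_EFinP.
pose g x := limn_einf (fun n => (f n x)%:E).
have mg : measurable_fun setT g.
  rewrite /g /limn_einf; apply: measurableT_comp => //.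
  apply: (measurable_fun_limn_esup (f := fun n x => (- (f n x)%:E)%E)) => n.
  exact: measurableT_comp (mfE n).
have limf (u : (\bar R)^nat) : limn_einf u = limf_einf u \oo by [].
have g0 x : (0 <= g x)%E.
  rewrite /g limf limf_einfE; apply: le_ereal_sup_tmp.
  exists (ereal_inf [set (f n x)%:E | n in setT]).
    by exists setT => //; exact: filterT.
  by apply: le_ereal_inf_tmp => _ [n _ <-]; rewrite lee_fin.
have gK : (\int[mu]_x g x <= K%:E)%E.
  apply: le_trans (fatou mu measurableT mfE _) _ => [n x _|].
    by rewrite lee_fin.
  rewrite limf limf_einfE; apply: ge_ereal_sup => _ [V [N _ NV] <-].
  apply: ge_ereal_inf; exists (\int[mu]_x (f N x)%:E)%E => //.
  by exists N => //; apply: NV => /=.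
have ig : mu.-integrable setT g.
  apply/integrableP; split=> //; under eq_integral => x _ do rewrite gee0_abs//.
  exact: le_lt_trans gK (ltry _).
have := integrable_ae measurableT ig; apply: filterS => x /(_ I) gx.
exists (fine (g x) + 1) => N.
have : (ereal_inf [set (f n x)%:E | n in [set n | (N <= n)%N]] <
    (fine (g x) + 1)%:E)%E.
  rewrite EFinD fineK//; apply: (@le_lt_trans _ _ (g x)); last by rewrite lteDl.
  rewrite /g limf limf_einfE; apply: ereal_sup_ubound.
  by exists [set n | (N <= n)%N] => //; exists N.
by move=> /ereal_inf_lt[_ [n Nn <-]]; rewrite lte_fin => /ltW; exists n.
Qed.
End WeightedEvents.

(** * Subspaces passing near a point *)

Section Near.
Variables (R : realType) (d m : nat) (hm : (m <= d)%N).
Local Notation G := (grassmannian R hm).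
Implicit Types (x y z v : 'rV[R]_d) (V W : G).

(** The inequality is strict so that this set of subspaces is open, hence
measurable. *)
Definition near_point z (c : R) : set G :=
  [set V | exists2 v, v \in subspace_of V & sqnorm (z - v) < c ^+ 2].

Lemma rowspanP (M : 'M[R]_(m, d)) v :
  reflect (exists u, v = u *m M) (v \in rowspan M).
Proof.
apply: (iffP idP) => [|[u ->]].
  have sub : (rowspan M <= limg (linfun (mulmxr M : 'rV_m -> 'rV_d)))%VS.
    apply/span_subvP => _ /mapP[i _ ->].
    have -> : row i M = linfun (mulmxr M : 'rV_m -> 'rV_d) (delta_mx 0 i).
      by rewrite lfunE/= rowE.
    exact: memv_img (memvf _).
  by move=> /(subvP sub)/memv_imgP[u _ ->]; exists u; rewrite lfunE.
rewrite mulmx_sum_row; apply: rpred_sum => i _; apply: rpredZ.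
by apply: memv_span; apply/mapP; exists i; rewrite ?mem_enum.
Qed.

Lemma open_near_point z c : open (near_point z c : set G).
Proof.
move=> M V [v vV zv] VM; move: vV; rewrite VM => /rowspanP[u vu].
have cont : continuous (fun M' : 'M[R]_(m, d) => sqnorm (z - u *m M')).
  rewrite /sqnorm; apply: continuous_big => [|i _]; first exact: add_continuous.
  under eq_fun => M' do rewrite !mxE expr2.
  have cont_i : continuous (fun M' : 'M[R]_(m, d) =>
      z ord0 i - \sum_j u ord0 j * M' j i).
    move=> M'; apply: continuousB; first exact: cst_continuous.
    move: M'; apply: continuous_big => [|j _ M']; first exact: add_continuous.
    by apply: continuousM; [exact: cst_continuous|exact: coord_continuous].
  by move=> M0; apply: cvgM; [exact: nbhs_filter|exact: cont_i..].
have := cvgr_lt _ (cont M) (c ^+ 2); rewrite -vu => /(_ _ zv).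
apply: filterS => M' zM' V' V'M'; exists (u *m M') => //.
by rewrite V'M'; apply/rowspanP; exists u.
Qed.

Lemma measurable_near_point z c :
  measurable (near_point z c : set (borel_grassmannian R hm)).
Proof. by apply: sub_sigma_algebra; exact: open_near_point. Qed.

Lemma near_pointZ (a c : R) z : 0 < a ->
  near_point (a *: z) (a * c) = near_point z c.
Proof.
move=> a0; apply/seteqP; split=> V [v vV zv].
  exists (a^-1 *: v); first exact: rpredZ.
  rewrite -[z](scalerK (lt0r_neq0 a0)) -scalerBr sqnormZ exprVn.
  by rewrite mulrC ltr_pdivrMr ?exprn_gt0// -exprMn mulrC.
exists (a *: v); first exact: rpredZ.
by rewrite -scalerBr sqnormZ exprMn ltr_pM2l ?exprn_gt0.
Qed.

Lemma near_point_shrink (a c : R) z : 0 <= a <= 1 ->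
  near_point z c `<=` near_point (a *: z) c.
Proof.
move=> /andP[a0 a1] V [v vV zv]; exists (a *: v); first exact: rpredZ.
rewrite -scalerBr sqnormZ; apply: le_lt_trans zv.
by rewrite ler_piMl ?sqnorm_ge0// exprn_ile1.
Qed.

Lemma near_point_image (g : 'M[R]_d) z c : g *m g^T = 1%:M ->
  [set V | exists2 W, near_point z c W &
     subspace_of V = (linfun (mulmxr g : 'rV_d -> 'rV_d) @: W)%VS] =
  near_point (z *m g) c.
Proof.
move=> gg; have gg' : g^T *m g = 1%:M by exact: mulmx1C.
apply/seteqP; split=> V.
  move=> [W [w wW zw] VW]; exists (w *m g).
    by rewrite VW -[w *m g](lfunE (mulmxr g)); exact: memv_img.
  by rewrite -mulmxBl sqnorm_orthogonal.
move=> [v vV zv].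
have dimW : \dim (linfun (mulmxr g^T : 'rV_d -> 'rV_d) @: V) == m.
  rewrite limg_dim_eq; first by case: (V).
  suff /eqP -> : lker (linfun (mulmxr g^T : 'rV_d -> 'rV_d)) == 0%VS.
    by rewrite capv0.
  apply/lker0P => x y; rewrite !lfunE/= => /(congr1 (mulmx^~ g)).
  by rewrite -!mulmxA gg' !mulmx1.
exists (Grassmannian _ dimW) => /=.
  exists (v *m g^T).
    by rewrite -[v *m _](lfunE (mulmxr g^T)); exact: memv_img.
  by rewrite -(sqnorm_orthogonal _ gg) mulmxBl -mulmxA gg' mulmx1.
rewrite -limg_comp.
suff -> : (linfun (mulmxr g) \o linfun (mulmxr g^T : 'rV_d -> 'rV_d))%VF = \1%VF.
  by rewrite lim1g.
by apply/lfunP => x; rewrite comp_lfunE !lfunE/= -mulmxA gg' mulmx1.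
Qed.

(** A point near V is determined up to a bounded error by the m coordinates over
which V is a graph, and these take at most (n + 1) ^ m values. *)
Lemma card_grid_near (n : nat) V (X : seq 'rV[int]_d) : uniq X ->
  (forall z : 'rV[int]_d, z \in X -> forall i, 0 <= z ord0 i <= n%:Z) ->
  (forall z : 'rV[int]_d, z \in X -> near_point (map_mx intr z) 1 V) ->
  (size X <= n.+1 ^ m * (m.*2.+2).*2.+1 ^ d)%N.
Proof.
move=> uX Xbox Xnear.
have [f Vf] := dominating_coords (eqP (valP V)).
pose F (z : 'rV[int]_d) : 'rV[int]_m := \row_i z ord0 (f i).
apply: leq_trans (_ : (size (values F X) * _ <= _)%N); last first.
  apply: leq_mul; last exact: leqnn.
  apply: (@size_le_box m m n 0) => [|y|y _ i]; first exact: undup_uniq.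
    rewrite mem_undup => /mapP[z zX ->] i; rewrite !mxE add0r; exact: Xbox.
  by rewrite leqNgt ltn_ord.
apply: size_le_values => // x y /Xnear[v vV xv] /Xnear[w wV yw] Fxy j.
have lt1 (u : 'rV[R]_d) i : sqnorm u < 1 ^+ 2 -> `|u ord0 i| < 1.
  move=> /(le_lt_trans (sqr_coord_le u i)).
  by rewrite -real_normK ?num_real// ltr_pXn2r ?nnegrE.
have dvw i : `|v ord0 (f i) - w ord0 (f i)| <= 2.
  have := lt1 _ (f i) xv; have := lt1 _ (f i) yw.
  move: Fxy => /rowP/(_ i); rewrite !mxE => ->.
  by rewrite ltr_norml ler_norml => /andP[? ?]; rewrite ltr_norml => /andP[? ?]; lra.
have vw : `|v ord0 j - w ord0 j| <= (m.*2)%:R.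
  have := Vf (v - w) (memvB vV wV) j; rewrite !mxE => /le_trans; apply.
  apply: le_trans (_ : \sum_(i < m) (2 : R) <= _).
    by apply: ler_sum => i _; rewrite !mxE.
  by rewrite sumr_const card_ord -muln2 natrM mulr_natl.
rewrite -(ler_int R) intr_norm rmorphB/= -natz.
have := lt1 _ j xv; have := lt1 _ j yw; rewrite !mxE.
rewrite (_ : (m.*2.+2)%:R%:~R = (m.*2)%:R + 2 :> R); last first.
  by rewrite natz -pmulrn -addn2 natrD.
move: vw; rewrite ler_norml => /andP[? ?].
rewrite ltr_norml => /andP[? ?]; rewrite ltr_norml => /andP[? ?].
by rewrite ler_norml; apply/andP; split; lra.
Qed.

End Near.

(** * Probability that a random subspace passes near a point *)

Section NearMeasure.
Variables (R : realType) (d m : nat) (hm : (m <= d)%N).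
Variable gamma : probability (borel_grassmannian R hm) R.
Hypothesis hgamma : orthogonal_invariant gamma.
Implicit Types (x y z v : 'rV[R]_d).

Definition near_prob z (c : R) : R := fine (gamma (near_point z c)).

Lemma le_near_prob y z b c : near_point (hm := hm) z c `<=` near_point y b ->
  near_prob z c <= near_prob y b.
Proof.
move=> yz; apply: fine_le; rewrite ?fin_num_measure//;
  try exact: measurable_near_point.
by apply: le_measure; rewrite ?inE//; exact: measurable_near_point.
Qed.

Lemma near_prob_rotate (g : 'M[R]_d) z c : g *m g^T = 1%:M ->
  near_prob (z *m g) c = near_prob z c.
Proof.
move=> gg; rewrite /near_prob -near_point_image//.
by rewrite (hgamma gg (measurable_near_point _ _)).
Qed.

(** After a rotation y and z have the same direction, and then every subspace
passing near z passes near the shorter vector y. *)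
Lemma near_prob_antimono y z c : sqnorm y <= sqnorm z ->
  near_prob z c <= near_prob y c.
Proof.
move=> yz; have [z0|z0] := eqVneq (sqnorm z) 0.
  have y0 : sqnorm y == 0 by rewrite eq_le sqnorm_ge0 -z0 yz.
  by move: z0 y0 => /eqP; rewrite !sqnorm_eq0 => /eqP -> /eqP ->.
have zpos : 0 < sqnorm z by rewrite lt_def z0 sqnorm_ge0.
pose a := Num.sqrt (sqnorm y / sqnorm z).
have [g [gg <-]] : exists g, g *m g^T = 1%:M /\ (a *: z) *m g = y.
  apply: orthogonal_transitive; rewrite sqnormZ sqr_sqrtr ?divfK//.
  by rewrite divr_ge0 ?sqnorm_ge0.
rewrite near_prob_rotate//; apply: le_near_prob; apply: near_point_shrink.
by rewrite sqrtr_ge0 -sqrtr1 ler_sqrt// ler_pdivrMr ?mul1r.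
Qed.

Definition grid (n : nat) : seq 'rV[int]_d :=
  [seq \row_i (f i)%:Z | f : {ffun 'I_d -> 'I_n.+1}].

(** The probability at z is at most the one at each shorter vector, hence at most
the average of these over a grid inside the ball of radius t; and each subspace
passes near a proportion of at most about t ^ - (d - m) of the grid. *)
Lemma near_prob_le : exists2 C, 0 < C & forall z t c, 1 <= c -> 0 <= t ->
  t ^+ 2 <= sqnorm z -> near_prob z c <= C * (c / (1 + t)) ^+ (d - m).
Proof.
pose K : R := ((m.*2.+2).*2.+1 ^ d)%:R.
have K0 : 0 < K by rewrite ltr0n expn_gt0.
have unit_bound z t : 0 <= t -> t ^+ 2 <= sqnorm z ->
    near_prob z 1 <= K * (d.+2%:R / (1 + t)) ^+ (d - m).
  (* The factor d + 1 puts the grid {0, ..., n} ^ d in the ball of radius t. *)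
  move=> t0 tz; pose n := `|Num.floor (t / d.+1%:R)|%N.
  have tn : n%:R <= t / d.+1%:R < n.+1%:R.
    have := floor_itv (t / d.+1%:R).
    have : 0 <= Num.floor (t / d.+1%:R) by rewrite floor_ge0 divr_ge0.
    rewrite /n; case: (Num.floor _) => // k _.
    by rewrite intrD -pmulrn natr1.
  have ugrid : uniq (grid n).
    rewrite map_inj_uniq ?enum_uniq// => f f' /rowP ff'; apply/ffunP => i.
    by have := ff' i; rewrite !mxE => -[/val_inj].
  have grid_box (y : 'rV[int]_d) : y \in grid n -> forall i, 0 <= y ord0 i <= n%:Z.
    by move=> /mapP[f _ ->] i; rewrite mxE /= lez_nat -ltnS ltn_ord.
  have average : (n.+1 ^ d)%:R * near_prob z 1 <= (n.+1 ^ m)%:R * K.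
    have -> : (n.+1 ^ d)%:R * near_prob z 1 = \sum_(y <- grid n) near_prob z 1.
      rewrite big_const_seq count_predT size_map -cardE card_ffun !card_ord.
      by rewrite iter_addr_0 mulr_natl.
    apply: le_trans (_ : \sum_(y <- grid n) 1 * near_prob (map_mx intr y) 1 <= _).
      rewrite big_seq [leRHS]big_seq; apply: ler_sum => y yg; rewrite mul1r.
      apply: near_prob_antimono; apply: le_trans tz.
      apply: le_trans (_ : d%:R * n%:R ^+ 2 <= _).
        apply: sqnorm_le => i; rewrite mxE -intr_norm pmulrn ler_int.
        by have := grid_box y yg i; lia.
      apply: le_trans (_ : (d.+1%:R * n%:R) ^+ 2 <= _).
        rewrite exprMn ler_wpM2r ?sqr_ge0// -natrX ler_nat.
        by apply: leq_trans (leqnSn d) _; rewrite expnS leq_pmulr.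
      rewrite lerXn2r ?nnegrE// mulrC -ler_pdivlMr//.
      by case/andP: tn.
    rewrite -lee_fin -(integral_weighted_events gamma)//; last first.
      by move=> y; exact: measurable_near_point.
    apply: le_trans (_ : (\int[gamma]_x cst ((n.+1 ^ m)%:R * K)%:E x <= _)%E);
      last first.
      by rewrite integral_cst// [X in (_ * X)%E]probability_setT mule1.
    apply: ge0_le_integral => //.
    - by move=> V _; rewrite lee_fin weighted_events_ge0.
    - apply/measurable_EFinP; apply: measurable_weighted_events => y.
      exact: measurable_near_point.
    move=> V _; rewrite lee_fin /weighted_events -natrM.
    under eq_bigr do rewrite mul1r indicE.
    rewrite -natr_sum -big_mkcond/= sum1_count -size_filter ler_nat.
    apply: (@card_grid_near R d m hm n V); first exact: filter_uniq.
    - by move=> y; rewrite mem_filter => /andP[_]; exact: grid_box.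
    - by move=> y; rewrite mem_filter => /andP[+ _]; rewrite inE.
  have N0 : (0 : R) < n.+1%:R by rewrite ltr0n.
  have {average} : near_prob z 1 <= K * (n.+1%:R^-1) ^+ (d - m).
    have Nd : (n.+1 ^ d)%:R = n.+1%:R ^+ (d - m) * n.+1%:R ^+ m :> R.
      by rewrite -exprD subnK// natrX.
    move: average; rewrite Nd natrX exprVn ler_pdivlMr ?exprn_gt0// mulrAC.
    by rewrite [leRHS]mulrC ler_pM2r ?exprn_gt0// mulrC.
  move=> /le_trans; apply; rewrite ler_pM2l//.
  apply: lerXn2r; rewrite ?nnegrE ?invr_ge0//.
    by rewrite divr_ge0// addr_ge0.
  rewrite ler_pdivlMr ?ltr_pwDl// mulrC ler_pdivrMr//.
  case/andP: tn => _; rewrite ltr_pdivrMr// => /ltW.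
  rewrite -[d.+2%:R]natr1 -[in X in _ -> X]natr1 -natr1.
  have : (0:R) <= n%:R by []. have : (0:R) <= d%:R by []. nra.
exists (K * d.+2%:R ^+ (d - m)); first by rewrite mulr_gt0 ?exprn_gt0.
move=> z t c c1 t0 tz; have c0 : 0 < c by exact: lt_le_trans c1.
have -> : near_prob z c = near_prob (c^-1 *: z) 1.
  by rewrite /near_prob -(@near_pointZ R d m hm c^-1 c z) ?invr_gt0// mulVf ?gt_eqF.
have c0' := ltW c0.
apply: le_trans (unit_bound _ (t / c) _ _) _; first by rewrite divr_ge0.
  by rewrite sqnormZ expr_div_n exprVn mulrC ler_pM2l// invr_gt0 exprn_gt0.
rewrite -mulrA -exprMn ler_pM2l//; apply: lerXn2r; rewrite ?nnegrE.
- by rewrite divr_ge0// addr_ge0// divr_ge0.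
- by rewrite mulr_ge0// divr_ge0// addr_ge0.
rewrite ler_pM2l// ler_pdivlMr ?ltr_pwDl// mulrC ler_pdivrMr ?ltr_pwDl ?divr_ge0//.
by rewrite mulrDr mulr1 mulrC divfK ?gt_eqF// lerD2r.
Qed.

End NearMeasure.

(** * Lattice points of cubes, and the two dimensions *)

Section Points.
Variables (R : realType) (d : nat).
Implicit Types (A : set 'rV[R]_d) (a : 'rV[R]_d) (s l alpha : R).
Implicit Types (X : seq 'rV[int]_d).

Definition points A a s : seq 'rV[int]_d :=
  finmap.enum_fset
    (fset_set (Defs.floor_set A `&` [set z | cube a s (map_mx intr z)])).

Definition centered_points A l := points A (const_mx (- l)) (2 * l).

Definition ceil_nat s : nat := `|Num.ceil s|%N.

Lemma ceil_natP s : 0 <= s -> s <= (ceil_nat s)%:R < s + 1.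
Proof.
move=> s0; have := ceil_itv s; rewrite /ceil_nat.
have : 0 <= Num.ceil s by rewrite ceil_ge0; lra.
case: (Num.ceil s) => // n _ /andP[+ ->]/=.
by rewrite intrD -pmulrn; lra.
Qed.

Lemma cube_ints_bounds a s (z : 'rV[int]_d) : 0 <= s -> cube a s (map_mx intr z) ->
  forall i, Num.ceil (a ord0 i) <= z ord0 i
            <= Num.ceil (a ord0 i) + (ceil_nat s)%:Z.
Proof.
move=> s0 az i; have := az i; rewrite mxE => /andP[az1 az2].
rewrite ceil_le_int az1/= -(ler_int R) intrD -pmulrn.
have := ceil_ge (a ord0 i); have /andP[? _] := ceil_natP s0; lra.
Qed.

Lemma finite_cube_ints a s :
  finite_set [set z : 'rV[int]_d | cube a s (map_mx intr z)].
Proof.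
pose r := Num.max s 0; pose n := ceil_nat r.
pose g (f : {ffun 'I_d -> 'I_n.+1}) : 'rV[int]_d :=
  \row_i (Num.ceil (a ord0 i) + (f i)%:Z).
apply: (@sub_finite_set _ _ (range g)); last exact: finite_image finite_finset.
move=> z az; have r0 : 0 <= r by rewrite le_max lexx orbT.
have azr : cube a r (map_mx intr z).
  move=> i; have /andP[-> zas] := az i; apply: lt_le_trans zas _.
  by rewrite lerD2l le_max lexx.
exists [ffun i => inord `|z ord0 i - Num.ceil (a ord0 i)|%N] => //.
apply/rowP => i; rewrite mxE ffunE -[z 0 i]/(z ord0 i).
have := cube_ints_bounds r0 azr i; rewrite -/n.
by move: (z ord0 i) (Num.ceil _) => u v uv; rewrite inordK; lia.
Qed.

Lemma finite_points A a s :
  finite_set (Defs.floor_set A `&` [set z | cube a s (map_mx intr z)]).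
Proof. exact: finite_setIr (finite_cube_ints a s). Qed.

Lemma mem_points A a s z :
  (z \in points A a s) <-> Defs.floor_set A z /\ cube a s (map_mx intr z).
Proof.
rewrite /points in_fset_set; last exact: finite_points.
by rewrite in_setE.
Qed.

Lemma uniq_points A a s : uniq (points A a s).
Proof. exact: finmap.fset_uniq. Qed.

Lemma cube_ratioE alpha A a s :
  cube_ratio alpha A a s = ((size (points A a s))%:R / s `^ alpha)%:E.
Proof.
by rewrite /cube_ratio /lattice_count /counting asboolT//; exact: finite_points.
Qed.

Lemma le_size_points A X a s : uniq X ->
  (forall z, z \in X -> Defs.floor_set A z /\ cube a s (map_mx intr z)) ->
  (size X <= size (points A a s))%N.
Proof. by move=> uX XA; apply: uniq_leq_size => // z /XA/mem_points. Qed.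

(** Only k coordinates are free, and each takes at most s + 2 <= 3 s values. *)
Lemma size_points_le (k : nat) A a s : 1 <= s ->
  (forall x, A x -> forall i : 'I_d, (k <= i)%N -> x ord0 i = 0) ->
  (size (points A a s))%:R <= 3 ^+ k * s ^+ k.
Proof.
move=> s1 A0; have s0 : 0 <= s by lra.
have : (size (points A a s) <= (ceil_nat s).+1 ^ k)%N.
  apply: (@size_le_box d k (ceil_nat s) (\row_i Num.ceil (a ord0 i))).
  - exact: uniq_points.
  - by move=> z /mem_points[_ az] i; rewrite mxE; exact: cube_ints_bounds.
  - by move=> z /mem_points[[x Ax <-] _] i ki; rewrite mxE (A0 x)// floor0.
rewrite -(ler_nat R) natrX => /le_trans; apply.
rewrite -exprMn; apply: lerXn2r; rewrite ?nnegrE//; first lra.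
by have /andP[_] := ceil_natP s0; rewrite -natr1; lra.
Qed.

Lemma size_points_le_full A a s : 1 <= s ->
  (size (points A a s))%:R <= 3 ^+ d * s ^+ d.
Proof. by move=> s1; apply: size_points_le => // x _ i; rewrite leqNgt ltn_ord. Qed.

Lemma mass_measure_ge0 alpha A : (0 <= mass_measure alpha A)%E.
Proof.
apply: limf_esup_ge0 => [|l]; first exact: (@filter_not_empty _ (pinfty_nbhs R)).
by rewrite cube_ratioE lee_fin divr_ge0// powR_ge0.
Qed.

Lemma mass_measure_eq0P alpha A : mass_measure alpha A = 0%E <->
  forall e, 0 < e -> exists L, forall l, L <= l -> 0 < l ->
    (size (centered_points A l))%:R <= e * (2 * l) `^ alpha.
Proof.
have ratioE l (e : R) : 0 < l ->
    (cube_ratio alpha A (const_mx (- l)%R) (2 * l)%R <= e%:E)%E =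
    ((size (centered_points A l))%:R <= e * (2 * l) `^ alpha).
  by move=> l0; rewrite cube_ratioE lee_fin ler_pdivrMr// powR_gt0// mulr_gt0.
split=> [m0 e e0|small].
  have : (mass_measure alpha A < e%:E)%E by rewrite m0 lte_fin.
  rewrite /mass_measure limf_esupE => /ereal_inf_lt[_ [V [L [_ LV]] <-] Ve].
  exists (L + 1) => l Ll l0; rewrite -ratioE//; apply: le_trans (ltW Ve).
  by apply: ereal_sup_ubound; exists l => //; apply: LV; lra.
apply/eqP; rewrite eq_le mass_measure_ge0 andbT; apply/lee_addgt0Pr => e e0.
rewrite add0e /mass_measure limf_esupE.
have [L Le] := small e e0; apply: ge_ereal_inf.
exists (ereal_sup [set cube_ratio alpha A (const_mx (- l)) (2 * l) |
                   l in [set l | Num.max L 0 < l]]); last first.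
  apply: ge_ereal_sup => _ [l + <-]; rewrite /= gt_max => /andP[Ll l0].
  by rewrite ratioE//; apply: Le => //; exact: ltW.
by exists [set l | Num.max L 0 < l] => //; exists (Num.max L 0); rewrite num_real.
Qed.

Lemma mass_measure_gt0P alpha A : (0 < mass_measure alpha A)%E <->
  exists2 e, 0 < e & forall L, exists l, [/\ L <= l, 0 < l &
    e * (2 * l) `^ alpha <= (size (centered_points A l))%:R].
Proof.
split=> [m0|[e e0 big]].
  apply: contrapT => no; move: m0; rewrite lt_neqAle mass_measure_ge0 andbT.
  suff -> : mass_measure alpha A = 0%E by rewrite eqxx.
  apply/mass_measure_eq0P => e e0; apply: contrapT => noL; apply: no.
  exists e => // L; apply: contrapT => nol; apply: noL; exists L => l Ll l0.
  by rewrite leNgt; apply/negP => /ltW ?; apply: nol; exists l.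
rewrite lt_neqAle mass_measure_ge0 andbT eq_sym.
apply/eqP => /mass_measure_eq0P/(_ (e / 2))[|L Le]; first by rewrite divr_gt0.
have [l [Ll l0 el]] := big L; have := le_trans el (Le l Ll l0).
by rewrite ler_pM2r ?powR_gt0 ?mulr_gt0//; lra.
Qed.

Lemma mass_measure_eq0_of_le alpha beta A (B L : R) : 0 < B -> alpha < beta ->
  (forall l, L <= l -> 0 < l ->
     (size (centered_points A l))%:R <= B * (2 * l) `^ alpha) ->
  mass_measure beta A = 0%E.
Proof.
move=> B0 ab AB; apply/mass_measure_eq0P => e e0.
pose L' := (B / e) `^ (beta - alpha)^-1.
have Be : 0 < B / e by rewrite divr_gt0.
exists (Num.max L L') => l; rewrite ge_max => /andP[Ll L'l] l0.
apply: le_trans (AB l Ll l0) _.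
rewrite -[beta](subrK alpha) powRD; last first.
  by rewrite (gt_eqF (_ : 0 < 2 * l)) ?implybT ?mulr_gt0.
rewrite mulrA ler_pM2r ?powR_gt0 ?mulr_gt0// -ler_pdivrMl// mulrC.
have -> : B / e = L' `^ (beta - alpha).
  by rewrite /L' -powRrM mulVf ?powRr1 ?ltW// subr_eq0 gt_eqF.
apply: ge0_ler_powR; rewrite ?nnegrE ?powR_ge0//; first by lra.
  by rewrite mulr_ge0// ltW.
by apply: le_trans L'l _; lra.
Qed.

Lemma mass_measure_eq0_le alpha beta A : alpha < beta ->
  mass_measure alpha A = 0%E -> mass_measure beta A = 0%E.
Proof.
move=> ab /mass_measure_eq0P/(_ 1 ltr01)[L AL].
exact: (mass_measure_eq0_of_le ltr01 ab AL).
Qed.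

Lemma mass_measure_eq0_gt (k : nat) alpha A : k%:R < alpha ->
  (forall x, A x -> forall i : 'I_d, (k <= i)%N -> x ord0 i = 0) ->
  mass_measure alpha A = 0%E.
Proof.
move=> ka A0; apply: (@mass_measure_eq0_of_le k%:R alpha A (3 ^+ k) 1) => //.
move=> l l1 l0; have l0' : 0 <= 2 * l by lra.
by rewrite powR_mulrn//; apply: size_points_le => //; lra.
Qed.

Let mass_set A := [set alpha | 0 <= alpha /\ mass_measure alpha A = 0%E].

Lemma mass_set_nonempty A : mass_set A !=set0.
Proof.
exists (d%:R + 1); split; first by rewrite addr_ge0.
by apply: (@mass_measure_eq0_gt d) => [|x _ i]; [lra|rewrite leqNgt ltn_ord].
Qed.

Lemma mass_dim_ge0 A : 0 <= mass_dim A.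
Proof. by apply: lb_le_inf; [exact: mass_set_nonempty|move=> ? []]. Qed.

Lemma mass_dim_le alpha A : 0 <= alpha -> mass_measure alpha A = 0%E ->
  mass_dim A <= alpha.
Proof.
move=> a0 ma; have : lbound (mass_set A) (inf (mass_set A)).
  by apply: ge_inf; exists 0 => ? [].
by apply.
Qed.

Lemma mass_measure_eq0_gt_dim alpha A :
  mass_dim A < alpha -> mass_measure alpha A = 0%E.
Proof.
move=> /(inf_lt (mass_set_nonempty A))[beta [b0 mb] ba].
exact: mass_measure_eq0_le mb.
Qed.

Lemma mass_measure_gt0_lt_dim alpha A : 0 <= alpha -> alpha < mass_dim A ->
  (0 < mass_measure alpha A)%E.
Proof.
move=> a0 aA; rewrite lt_neqAle mass_measure_ge0 andbT eq_sym.
by apply/eqP => /(mass_dim_le a0); rewrite leNgt aA.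
Qed.

Lemma le_mass_dim alpha A : (0 < mass_measure alpha A)%E -> alpha <= mass_dim A.
Proof.
move=> ma; rewrite leNgt; apply/negP => /mass_measure_eq0_gt_dim m0.
by move: ma; rewrite m0 ltxx.
Qed.

Let sup_ratio alpha A l := ereal_sup [set y | exists a s,
         [/\ 0 < s, l <= s & y = cube_ratio alpha A a s]].

Lemma counting_measure_bound alpha A : 0 <= alpha ->
  (counting_measure alpha A < +oo)%E ->
  exists2 B, 0 < B & forall a s, 1 <= s ->
    (size (points A a s))%:R <= B * s `^ alpha.
Proof.
move=> alpha0 fin.
(* If the suprema were all infinite, so would be their limit. *)
have [L [L1 [b bL]]] : exists L, 1 <= L /\
    exists b : R, (sup_ratio alpha A L <= b%:E)%E.
  apply: contrapT => no; move: fin; rewrite /counting_measure.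
  suff -> : lim (sup_ratio alpha A l @[l --> +oo]) = +oo%E by rewrite ltxx.
  apply: cvg_lim => //.
  apply: cvg_near_cst; exists 1; split=> // l l1.
  case El : (sup_ratio alpha A l) => [r| |] //; exfalso; apply: no; exists l.
    by split; [exact: ltW|exists r; rewrite El].
  by split; [exact: ltW|exists 0; rewrite El leNye].
have L0 : 0 < L by exact: lt_le_trans L1.
have b0 : 0 <= b.
  rewrite -lee_fin; apply: le_trans bL; apply: le_ereal_sup_tmp.
  exists (cube_ratio alpha A 0 L); first by exists 0, L.
  by rewrite cube_ratioE lee_fin divr_ge0// powR_ge0.
have large a s : L <= s -> (size (points A a s))%:R <= b * s `^ alpha.
  move=> Ls; have s0 : 0 < s by exact: lt_le_trans Ls.
  rewrite -ler_pdivrMr ?powR_gt0// -lee_fin -cube_ratioE.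
  by apply: le_trans bL; apply: ereal_sup_ubound; exists a, s.
exists (b * L `^ alpha + 1) => [|a s s1].
  by apply: ltr_wpDl => //; rewrite mulr_ge0 ?powR_ge0.
have s0 : 0 < s by exact: lt_le_trans s1.
have s1' : 1 <= s `^ alpha by rewrite -(powRr0 s); apply: ler_powR.
have L1' : 1 <= L `^ alpha by rewrite -(powRr0 L); apply: ler_powR.
have [Ls|sL] := leP L s.
  apply: le_trans (large a s Ls) _; rewrite ler_wpM2r ?powR_ge0//; nra.
apply: le_trans (_ : (size (points A a L))%:R <= _).
  rewrite ler_nat; apply: le_size_points => [|z]; first exact: uniq_points.
  move=> /mem_points[Az az]; split=> // i; have /andP[-> /= h] := az i.
  by apply: lt_le_trans h _; rewrite lerD2l ltW.
apply: le_trans (large a L (lexx _)) _.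
apply: le_trans (_ : (b * L `^ alpha + 1) * 1 <= _); first lra.
by rewrite ler_wpM2l// addr_ge0// mulr_ge0 ?powR_ge0.
Qed.

Let counting_set A := [set alpha | 0 <= alpha /\ counting_measure alpha A = 0%E].

Lemma counting_set_nonempty A : counting_set A !=set0.
Proof.
exists (d%:R + 1); split; first by rewrite addr_ge0.
apply: cvg_lim => //.
have hcvg : (3 ^+ d * l^-1)%:E @[l --> +oo%R] --> (0%E : \bar R).
  apply: cvg_EFin; first by near=> l.
  rewrite -[X in _ --> X](mulr0 (3 ^+ d)); apply: cvgMl_tmp.
  apply/gtr0_cvgV0; first by near=> l; near: l; exact: nbhs_pinfty_gt.
  exact: cvg_id.
apply: (squeeze_cvge _ (cvg_cst _) hcvg).
exists 1; split => // l l1; have l0 : 0 < l by lra.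
apply/andP; split.
  apply: le_ereal_sup_tmp; exists (cube_ratio (d%:R + 1) A 0 l).
    by exists 0, l.
  by rewrite cube_ratioE lee_fin divr_ge0// powR_ge0.
apply: ge_ereal_sup => _ [a [s [s0 ls ->]]].
rewrite cube_ratioE lee_fin ler_pdivrMr ?powR_gt0//.
apply: le_trans (size_points_le_full _ _ _) _; first lra.
have s0' := ltW s0.
rewrite powRD ?(gt_eqF s0) ?implybT// powRr1// powR_mulrn//.
rewrite -mulrA ler_pM2l ?exprn_gt0// mulrCA ler_pMr ?exprn_gt0//.
by rewrite ler_pdivlMl// mulr1.
Unshelve. all: by end_near.
Qed.

Lemma counting_dim_ge0 A : 0 <= counting_dim A.
Proof. by apply: lb_le_inf; [exact: counting_set_nonempty|move=> ? []]. Qed.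

Lemma counting_dim_bound beta A : counting_dim A < beta ->
  exists2 B, 0 < B & forall a s, 1 <= s ->
    (size (points A a s))%:R <= B * s `^ beta.
Proof.
move=> /(inf_lt (counting_set_nonempty A))[alpha [a0 ma] ab].
have [|B B0 AB] := @counting_measure_bound alpha A a0; first by rewrite ma.
exists B => // a s s1; apply: le_trans (AB a s s1) _.
by rewrite ler_pM2l// ler_powR// ltW.
Qed.

End Points.

(** * Dyadic scales and energy *)

Section Scale.
Variables (R : realType) (d : nat).
Implicit Types (A : set 'rV[R]_d) (x y z w : 'rV[int]_d).

(** Distances are measured as 1 + |z|, which gives the origin the scale 0. *)
Definition scale z : nat := trunc_log 2 (int_norm z).+1.

Lemma scale_bounds z : (2 ^ scale z <= (int_norm z).+1 < 2 ^ (scale z).+1)%N.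
Proof. by rewrite trunc_logP// trunc_log_ltn. Qed.

Lemma int_norm_lt (n : nat) z : ((int_norm z).+1 < n)%N ->
  forall i, `|z ord0 i| < n%:Z.
Proof.
move=> zn i; have /int_norm_le/(_ i) := leqnn (int_norm z).
move=> /le_lt_trans; apply; rewrite ltz_nat; exact: ltn_trans zn.
Qed.

(** These points lie in the cube of center x and side 2 ^ (i + 2). *)
Lemma count_scale A (beta B : R) X x i :
  (forall a s, 1 <= s -> (size (points A a s))%:R <= B * s `^ beta) ->
  uniq X -> (forall y, y \in X -> Defs.floor_set A y) ->
  (count (fun y => scale (x - y) == i) X)%:R <= B * 4 `^ beta * (2 `^ beta) ^+ i.
Proof.
move=> AB uX XA.
pose s : R := 2 ^+ i.+2; have s1 : 1 <= s by rewrite exprn_ege1// ler1n.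
pose a : 'rV[R]_d := map_mx intr x - const_mx (2 ^+ i.+1).
apply: le_trans (_ : (size (points A a s))%:R <= _).
  rewrite ler_nat -size_filter.
  apply: le_size_points => [|y]; first exact: filter_uniq.
  rewrite mem_filter => /andP[/eqP yi yX]; split; first exact: XA.
  have /andP[_] := scale_bounds (x - y); rewrite yi => /int_norm_lt xy j.
  have := xy j; rewrite !mxE -(ltr_int R) intr_norm rmorphB/= -pmulrn natrX.
  rewrite /s [2 ^+ i.+2]exprS ltr_norml => /andP[? ?].
  by apply/andP; split; lra.
apply: le_trans (AB a s s1) _; rewrite /s -mulrA.
have -> : (2 : R) ^+ i.+2 = 4 * 2 `^ i%:R.
  by rewrite powR_mulrn// !exprS mulrA; congr (_ * _); ring.
by rewrite powRM ?powR_ge0// -powRrM [_%:R * _]mulrC powRrM powR_mulrn ?powR_ge0.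
Qed.

(** The points at scale i contribute about 2 ^ (i (beta - k)).  As beta <> k, one
end of this geometric progression dominates: the small scales if beta < k, and
otherwise the largest scale, where 2 ^ i is comparable to l. *)
Lemma riesz_energy_le A (k : nat) (beta B : R) :
  0 <= beta -> beta != k%:R -> 0 < B ->
  (forall a s, 1 <= s -> (size (points A a s))%:R <= B * s `^ beta) ->
  exists2 K, 0 < K & forall l x, 1 <= l -> x \in centered_points A l ->
    \sum_(y <- centered_points A l) (2 ^+ k)^-1 ^+ scale (x - y)
      <= K * l `^ Num.max 0 (beta - k%:R).
Proof.
move=> beta0 betak B0 AB; set mu := Num.max 0 (beta - k%:R).
have mu0 : 0 <= mu by rewrite le_max lexx.
pose q : R := 2 `^ beta * (2 ^+ k)^-1.
have qE : q = 2 `^ (beta - k%:R).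
  by rewrite powRD ?pnatr_eq0 ?implybT// powRN powR_mulrn.
have q0 : 0 <= q by rewrite qE powR_ge0.
have ln2 : ln (2 : R) != 0 by rewrite gt_eqF// ln_gt0// ltr1n.
have q1 : q != 1.
  rewrite qE; apply/eqP => /(congr1 (@ln R)); rewrite ln_powR ln1 => /eqP.
  by rewrite mulf_eq0 (negPf ln2) orbF subr_eq0 (negPf betak).
have [C C0 sumC] := geometric_sum_le q0 q1.
exists (B * 4 `^ beta * C * 6 `^ mu); first by rewrite !mulr_gt0// powR_gt0.
move=> l x l1 xX; have l0 : 0 <= l by lra.
(* For x and y in the box, 1 + |x - y| <= 1 + 2 l <= 3 l < 2 ^ N. *)
pose N := (trunc_log 2 (Num.truncn (3 * l))).+1.
have lN : 2 ^+ N <= 6 * l.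
  rewrite exprS -(_ : 2 * (3 * l) = 6 * l); last by ring.
  rewrite ler_pM2l// -natrX -truncn_ge_nat; last by lra.
  by apply: trunc_logP => //; rewrite truncn_ge_nat; lra.
have scaleN y : y \in centered_points A l -> (scale (x - y) < N)%N.
  move=> yX; rewrite ltnS; apply: leq_trunc_log.
  rewrite truncn_ge_nat; last by lra.
  have [->|[i ->]] := int_norm_coord (x - y); first by lra.
  rewrite -natr1 natr_absz !mxE intr_norm rmorphB/=.
  have /mem_points[_ /(_ i)] := xX; have /mem_points[_ /(_ i)] := yX.
  rewrite !mxE => /andP[? ?] /andP[? ?].
  have : `|(x ord0 i)%:~R - (y ord0 i)%:~R| <= 2 * l :> R.
    by rewrite ler_norml; apply/andP; split; lra.
  lra.
apply: le_trans (_ : B * 4 `^ beta * \sum_(i < N) q ^+ i <= _).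
  apply: (dyadic_sum (j := fun y => scale (x - y))) => //.
  move=> i; apply: (count_scale _ _ AB); first exact: uniq_points.
  by move=> y /mem_points[].
rewrite -!mulrA ler_pM2l// ler_pM2l ?powR_gt0//.
apply: le_trans (sumC N) _; rewrite ler_pM2l//.
have -> : Num.max 1 q = 2 `^ mu.
  have mono : {homo powR (2 : R) : u v / u <= v} by apply: ler_powR; rewrite ler1n.
  rewrite /mu qE; case: (leP 0 (beta - k%:R)) => [/mono|/ltW/mono]; rewrite powRr0.
    by move=> ?; exact: max_r.
  by move=> ?; exact: max_l.
rewrite -powR_mulrn ?powR_ge0// -powRrM mulrC powRrM powR_mulrn// -powRM//.
by apply: ge0_ler_powR => //; rewrite nnegrE ?exprn_ge0// mulr_ge0.
Qed.

End Scale.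

(** * Short projections and near subspaces *)

Section Projections.
Variables (R : realType) (d k : nat) (hk : (k <= d)%N).
Variable gamma : probability (borel_grassmannian R (leq_subr k d)) R.
Hypothesis hgamma : orthogonal_invariant gamma.

(** The vector z - P z belongs to the null space V of P, and it is at distance
|P z| from z. *)
Lemma projection_near_point (P : 'End('rV[R]_d)) (V : grassmannian R (leq_subr k d))
    (z : 'rV[R]_d) (r : R) :
  projection_onto_coords k P -> lker P = V -> 0 < r ->
  (forall i, `|P z ord0 i| <= r) -> near_point z (d.+1%:R * r) V.
Proof.
move=> [PP _] kerP r0 Pzr; exists (z - P z).
  by rewrite -kerP memv_ker linearB/= -[P (P z)]comp_lfunE PP subrr.
rewrite opprB addrC subrK; apply: le_lt_trans (sqnorm_le Pzr) _.
rewrite exprMn ltr_pM2r ?exprn_gt0// -natrX ltr_nat.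
by rewrite (leq_trans (ltnSn d))// expnS leq_pmulr.
Qed.

(** The same estimate as in near_prob_le with the distance read off a nearby
lattice point. *)
Lemma near_prob_scale : exists2 C, 0 < C & forall c (z : 'rV[R]_d) (w : 'rV[int]_d),
  1 <= c -> (forall i, `|z ord0 i - (w ord0 i)%:~R| <= 1) ->
  near_prob gamma z c <= C * c ^+ k * (2 ^+ k)^-1 ^+ scale w.
Proof.
have [C C0 near_le] := near_prob_le hgamma; rewrite subKn// in near_le.
exists (C * 2 ^+ k) => [|c z w c1 zw]; first by rewrite mulr_gt0// exprn_gt0.
have c0 : 0 <= c by lra.
pose t : R := Num.max 0 ((int_norm w)%:R - 1).
have t0 : 0 <= t by rewrite le_max lexx.
have tz : t ^+ 2 <= sqnorm z.
  have [w0|[i wi]] := int_norm_coord w.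
    by rewrite /t w0 max_l ?expr0n ?sqnorm_ge0//; lra.
  apply: le_trans (sqr_coord_le z i); rewrite -[leRHS]real_normK ?num_real//.
  apply: lerXn2r; rewrite ?nnegrE// ge_max normr_ge0/= wi natr_absz intr_norm.
  have := zw i; rewrite distrC => zwi.
  have := ler_normD ((w ord0 i)%:~R - z ord0 i) (z ord0 i); rewrite subrK; lra.
apply: le_trans (near_le z t c c1 t0 tz) _.
rewrite -!mulrA ler_pM2l// -exprVn exprAC -!exprMn; apply: lerXn2r.
- by rewrite nnegrE divr_ge0// addr_ge0.
- by rewrite nnegrE !mulr_ge0// exprn_ge0 ?invr_ge0.
rewrite mulrCA ler_wpM2l// exprVn ler_pdivlMr ?exprn_gt0//.
rewrite mulrC ler_pdivrMr ?ltr_pwDl//.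
have /andP[+ _] := scale_bounds w; rewrite -(ler_nat R) natrX -natr1.
have : (int_norm w)%:R - 1 <= t by rewrite le_max lexx orbT.
lra.
Qed.

End Projections.

(** * Almost every projection of a set with many points is large *)

Section AlmostEveryProjection.
Variables (R : realType) (d k : nat) (hk : (k <= d)%N).
Variable gamma : probability (borel_grassmannian R (leq_subr k d)) R.
Hypothesis hgamma : orthogonal_invariant gamma.
Implicit Types (A : set 'rV[R]_d) (P : 'End('rV[R]_d)).

Lemma floor_section (S : set 'rV[R]_d) (g : 'rV[R]_d -> 'rV[R]_d) :
  exists a : 'rV[int]_d -> 'rV[R]_d, forall w, Defs.floor_set (g @` S) w ->
    S (a w) /\ map_mx Num.floor (g (a w)) = w.
Proof.
have /choice[a aP] (w : 'rV[int]_d) : exists x, Defs.floor_set (g @` S) w ->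
    S x /\ map_mx Num.floor (g x) = w; last by exists a.
have [[_ [x Sx <-] xw]|no] := pselect (Defs.floor_set (g @` S) w); last first.
  by exists 0 => /no.
by exists x.
Qed.

Lemma floor_diff (x : 'rV[R]_d) w : map_mx Num.floor x = w -> forall i,
  0 <= x ord0 i - (w ord0 i)%:~R < 1.
Proof.
move=> <- i; rewrite mxE; have := floor_itv (x ord0 i); rewrite intrD.
by move=> /andP[? ?]; apply/andP; split; lra.
Qed.

(** The functions f n are the numbers of pairs of points of A in a box of
half-side l n whose projections may coincide after rounding, divided by the
square of the number of points and multiplied by l n ^ theta.  The energy
estimate bounds their integrals; where they are bounded, the projected box
contains at least about l n ^ theta lattice points, by Cauchy--Schwarz. *)
Lemma ae_mass_measure_gt0 A (beta beta' B : R) :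
  0 <= beta -> beta != k%:R -> 0 < B ->
  (forall a s, 1 <= s -> (size (points A a s))%:R <= B * s `^ beta) ->
  (0 < mass_measure beta' A)%E ->
  ae_projection gamma (fun P =>
    (0 < mass_measure (beta' - Num.max 0 (beta - k%:R))%R (P @` A))%E).
Proof.
move=> beta0 betak B0 AB /mass_measure_gt0P[e e0 big].
set mu := Num.max 0 _; set theta := (beta' - mu)%R.
have /choice[l lP] (n : nat) : exists l, [/\ n.+1%:R <= l, 0 < l &
    e * (2 * l) `^ beta' <= (size (centered_points A l))%:R] by exact: big.
have [a aP] := floor_section A id; rewrite image_id in aP.
pose X n := centered_points A (l n).
have XA n x : x \in X n -> A (a x) /\ map_mx Num.floor (a x) = x.
  by move=> /mem_points[/aP].
have X0 n : 0 < (size (X n))%:R :> R.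
  case: (lP n) => _ l0; apply: lt_le_trans.
  by rewrite mulr_gt0// powR_gt0// mulr_gt0.
pose c : R := d.+1%:R * 1.
have c1 : 1 <= c by rewrite /c mulr1 ler1n.
pose wt n : R := l n `^ theta / (size (X n))%:R ^+ 2.
have wt0 n : 0 < wt n.
  by case: (lP n) => _ l0 _; rewrite divr_gt0 ?powR_gt0// exprn_gt0.
pose E (p : 'rV[int]_d * 'rV[int]_d) :=
  near_point (hm := leq_subr k d) (a p.1 - a p.2) c.
pose f n := weighted_events [seq (x, y) | x <- X n, y <- X n] (fun _ => wt n)
  (E : _ -> set (borel_grassmannian R (leq_subr k d))).
have [K K0 energy] := riesz_energy_le beta0 betak B0 AB; rewrite -/mu in energy.
have [C C0 near_le] := near_prob_scale hk hgamma.
pose K' := C * c ^+ k * K / (e * 2 `^ beta').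
have mE p : measurable (E p : set (borel_grassmannian R (leq_subr k d))).
  exact: measurable_near_point.
have int_f n : (\int[gamma]_x (f n x)%:E <= K'%:E)%E.
  rewrite integral_weighted_events// => [|_]; last exact: ltW.
  have [ln l0 lX] := lP n.
  rewrite lee_fin big_allpairs/=.
  have inner x : x \in X n -> \sum_(y <- X n) wt n * fine (gamma (E (x, y)))
      <= wt n * (C * c ^+ k * (K * l n `^ mu)).
    move=> xX; rewrite -mulr_sumr ler_pM2l//.
    apply: le_trans (_ : C * c ^+ k *
        \sum_(y <- X n) (2 ^+ k)^-1 ^+ scale (x - y) <= _); last first.
      rewrite ler_pM2l ?mulr_gt0 ?exprn_gt0//; last lra.
      apply: energy => //; apply: le_trans ln; by rewrite ler1n.
    rewrite mulr_sumr !big_seq; apply: ler_sum => y yX.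
    apply: near_le => // i; rewrite !mxE rmorphB/=.
    have [_ /floor_diff/(_ i)/andP[? ?]] := XA n x xX.
    have [_ /floor_diff/(_ i)/andP[? ?]] := XA n y yX.
    by rewrite ler_norml; apply/andP; split; lra.
  apply: le_trans (_ : \sum_(x <- X n) wt n * (C * c ^+ k * (K * l n `^ mu)) <= _).
    by rewrite !big_seq; apply: ler_sum => x; exact: inner.
  rewrite big_const_seq count_predT iter_addr_0 -mulr_natl /wt /K'.
  have -> : (size (X n))%:R * (l n `^ theta / (size (X n))%:R ^+ 2 *
      (C * c ^+ k * (K * l n `^ mu))) =
      C * c ^+ k * K * (l n `^ theta * l n `^ mu) / (size (X n))%:R.
    by field; rewrite gt_eqF.
  rewrite -powRD ?(gt_eqF l0) ?implybT// subrK.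
  rewrite -mulrA ler_pM2l; last by rewrite !mulr_gt0// exprn_gt0//; lra.
  rewrite ler_pdivrMr// ler_pdivlMl ?mulr_gt0 ?powR_gt0//.
  by move: lX; rewrite powRM ?mulrA// ltW.
have mf n : measurable_fun setT (f n) by exact: measurable_weighted_events.
have f0 n x : 0 <= f n x by apply: weighted_events_ge0 => _; exact: ltW.
have := ae_bounded_infinitely_often mf f0 int_f.
apply: filterS => V [M fM] P projP kerP.
have [Kp Kp0 Pbound] := endo_bounded P.
pose M' := Num.max M 1; have M'0 : 0 < M' by rewrite lt_max ltr01 orbT.
(* P maps the box of half-side l n + 1 into the one of half-side Kp (l n + 1);
rounding and l n >= 1 account for the rest of L. *)
pose L := 2 * Kp + 2; have L0 : 0 < L by rewrite /L; lra.
apply/mass_measure_gt0P; exists (M' * (2 * L) `^ theta)^-1.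
  by rewrite invr_gt0 mulr_gt0// powR_gt0// mulr_gt0.
move=> L1; have [n Nn fnM] := fM (ceil_nat (Num.max L1 0)).
have [ln l0 lX] := lP n; have l1 : 1 <= l n by apply: le_trans ln; rewrite ler1n.
exists (L * l n); split; last 1 first.
- pose phi x := map_mx Num.floor (P (a x)) : 'rV[int]_d.
  have Y_le : (size (values phi (X n)))%:R <=
      (size (centered_points (P @` A) (L * l n)))%:R :> R.
    rewrite ler_nat; apply: le_size_points => [|u]; first exact: undup_uniq.
    rewrite mem_undup => /mapP[x xX ->].
    have [Aa ax] := XA n x xX; split; first by exists (P (a x)) => //; exists (a x).
    have ax_le i : `|a x ord0 i| <= l n + 1.
      have /mem_points[_ /(_ i)] := xX; rewrite !mxE => /andP[? ?].
      have /andP[? ?] := floor_diff ax i.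
      by rewrite ler_norml; apply/andP; split; lra.
    move=> i; have := Pbound _ _ ax_le i.
    have /andP[? ?] := floor_diff (x := P (a x)) erefl i.
    have : Kp * (l n + 1) <= Kp * (2 * l n) by rewrite ler_wpM2l//; lra.
    rewrite ler_norml 2!mxE -/(phi x) /L => ? /andP[? ?].
    by apply/andP; split; nra.
  apply: le_trans Y_le.
  have pairs_le :
      wt n * (\sum_(x <- X n) \sum_(y <- X n) (phi x == phi y)%:R) <= M'.
    apply: le_trans (_ : f n V <= _); last by rewrite le_max fnM.
    rewrite /f /weighted_events big_allpairs mulr_sumr.
    apply: ler_sum => x _; rewrite mulr_sumr; apply: ler_sum => y _ /=.
    rewrite ler_pM2l// indicE ler_nat; case: eqP => // xy.
    rewrite mem_set//; apply: projection_near_point projP kerP ltr01 _ => i.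
    rewrite linearB/= !mxE.
    have /andP[? ?] := floor_diff (x := P (a x)) erefl i.
    have /andP[? ?] := floor_diff (x := P (a y)) (esym xy) i.
    by rewrite ler_norml; apply/andP; split; lra.
  have L2 : 0 < 2 * L by rewrite mulr_gt0.
  have -> : (2 * (L * l n)) `^ theta = (2 * L) `^ theta * l n `^ theta.
    by rewrite mulrA powRM// ltW.
  rewrite invfM -mulrA mulKf ?gt_eqF ?powR_gt0//.
  rewrite ler_pdivrMl//.
  set pairs := (\sum_(x <- X n) _) in pairs_le *.
  have := values_lower phi (X n) R; rewrite -/pairs => CS.
  apply: le_trans (_ : (size (values phi (X n)))%:R * (wt n * pairs) <= _);
    last first.
    by rewrite mulrC ler_wpM2r.
  rewrite mulrCA /wt mulrAC -mulrA ler_peMr ?powR_ge0//.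
  by rewrite ler_pdivlMr ?exprn_gt0// mul1r.
- apply: le_trans (_ : L1 <= l n) _.
    have m0 : 0 <= Num.max L1 0 by rewrite le_max lexx orbT.
    have /andP[+ _] := ceil_natP m0; rewrite ge_max => /andP[/le_trans + _]; apply.
    apply: le_trans ln; rewrite ler_nat; exact: leq_trans Nn (leqnSn n).
  by rewrite ler_peMl ?(ltW l0)// /L; lra.
- by rewrite mulr_gt0.
Qed.

End AlmostEveryProjection.

(** * Almost every projection of a sparse set is small *)

Section SparseSets.
Variables (R : realType) (d k : nat) (hk : (k <= d)%N).
Variable gamma : probability (borel_grassmannian R (leq_subr k d)) R.
Hypothesis hgamma : orthogonal_invariant gamma.
Implicit Types (A : set 'rV[R]_d) (P : 'End('rV[R]_d)).

Lemma size_centered_points_mono A (r l : R) : r <= l ->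
  (size (centered_points A r) <= size (centered_points A l))%N.
Proof.
move=> rl; apply: le_size_points => [|z]; first exact: uniq_points.
move=> /mem_points[Az rz]; split=> // i; have := rz i.
by rewrite !mxE => /andP[? ?]; apply/andP; split; lra.
Qed.

Lemma mem_centered_points_scale A n (w : 'rV[int]_d) : Defs.floor_set A w ->
  (scale w < n)%N -> w \in centered_points A (2 ^+ n : R).
Proof.
move=> Aw wn; apply/mem_points; split=> // i.
have /andP[_ w_lt] := scale_bounds w.
have := int_norm_lt (leq_trans w_lt (leq_pexp2l (isT : 0 < 2)%N wn)) i.
rewrite !mxE -(ltr_int R) intr_norm -pmulrn natrX ltr_norml => /andP[? ?].
by apply/andP; split; lra.
Qed.

Lemma centered_points_bound A (alpha : R) : 0 <= alpha ->
  mass_measure alpha A = 0%E ->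
  exists2 B, 0 < B & forall l, 1 <= l ->
    (size (centered_points A l))%:R <= B * (2 * l) `^ alpha.
Proof.
move=> alpha0 /mass_measure_eq0P/(_ 1 ltr01)[L AL].
pose L' := Num.max L 1; have L'1 : 1 <= L' by rewrite le_max lexx orbT.
have pow1 (l : R) : 1 <= l -> 1 <= (2 * l) `^ alpha.
  by move=> l1; rewrite -[leLHS](powRr0 (2 * l)); apply: ler_powR => //; lra.
exists ((2 * L') `^ alpha); first by rewrite powR_gt0//; lra.
move=> l l1; have [L'l|/ltW lL'] := leP L' l.
  apply: le_trans (AL l _ _) _; [|lra|].
    by apply: le_trans L'l; rewrite le_max lexx.
  by rewrite ler_wpM2r ?powR_ge0// pow1.
apply: le_trans (_ : (size (centered_points A L'))%:R <= _).
  by rewrite ler_nat size_centered_points_mono.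
apply: le_trans (AL L' _ _) _; [by rewrite le_max lexx|lra|].
by rewrite mul1r ler_peMr ?powR_ge0// pow1.
Qed.

Lemma count_scale_le A (alpha B : R) (X : seq 'rV[int]_d) i :
  (forall l, 1 <= l -> (size (centered_points A l))%:R <= B * (2 * l) `^ alpha) ->
  uniq X -> (forall w, w \in X -> Defs.floor_set A w) ->
  (count (fun w => (scale w <= i)%N) X)%:R <= B * 4 `^ alpha * (2 `^ alpha) ^+ i.
Proof.
move=> AB uX XA.
apply: le_trans (_ : (size (centered_points A (2 ^+ i.+1)))%:R <= _).
  rewrite ler_nat -size_filter; apply: uniq_leq_size; first exact: filter_uniq.
  move=> w; rewrite mem_filter => /andP[wi wX].
  by apply: mem_centered_points_scale; [exact: XA|rewrite ltnS].
apply: le_trans (AB _ _) _; first by rewrite exprn_ege1// ler1n.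
rewrite -mulrA; have -> : 2 * (2 : R) ^+ i.+1 = 4 * 2 `^ i%:R.
  by rewrite powR_mulrn// !exprS mulrA; congr (_ * _); ring.
by rewrite powRM ?powR_ge0// -powRrM [_%:R * _]mulrC powRrM powR_mulrn ?powR_ge0.
Qed.

Lemma ler_sum_uniq_sub (T : eqType) (X Y : seq T) (g : T -> R) : uniq X -> uniq Y ->
  {subset X <= Y} -> (forall x, 0 <= g x) -> \sum_(x <- X) g x <= \sum_(x <- Y) g x.
Proof.
move=> uX uY XY g0; have XYX : perm_eq X [seq y <- Y | y \in X].
  apply: uniq_perm; rewrite ?filter_uniq// => x; rewrite mem_filter.
  by case: (boolP (x \in X)) => // /XY ->.
rewrite (perm_big _ XYX)/= big_filter big_mkcond; apply: ler_sum => x _.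
by case: ifP.
Qed.

(** A Borel--Cantelli argument over all scales at once.  The function f n sums
t ^ i, with t = 2 ^ - alpha', over the points w of A at scale less than n and
the scales i < scale w for which V passes within about 2 ^ i of w, that is, P w
may have length 2 ^ i.  Its integral is bounded because the sum over i is
dominated by i = scale w, so that w contributes about t ^ scale w, and A has at
most about 2 ^ (j alpha) points at scale j.  Where f n stays bounded, at most
about 2 ^ (i alpha') points of A at scale more than i project into the box of
half-side 2 ^ i, and there are at most about 2 ^ (i alpha) points at scale
at most i. *)
Lemma ae_mass_measure_eq0 A (alpha alpha' : R) :
  0 <= alpha -> alpha < alpha' -> alpha' < k%:R ->
  mass_measure alpha A = 0%E ->
  ae_projection gamma (fun P => forall alpha'', alpha' < alpha'' ->
    mass_measure alpha'' (P @` A) = 0%E).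
Proof.
move=> alpha0 aa' a'k /(centered_points_bound alpha0)[B B0 AB].
pose t : R := (2 `^ alpha')^-1; have t0 : 0 < t by rewrite invr_gt0 powR_gt0.
pose X n := [seq w <- centered_points A (2 ^+ n) | (scale w < n)%N].
have uX n : uniq (X n) by rewrite filter_uniq// uniq_points.
have XA n w : w \in X n -> Defs.floor_set A w.
  by rewrite mem_filter => /andP[_ /mem_points[]].
(* The factor 2 absorbs the rounding errors once 2 ^ i >= 1 + Kp below. *)
pose c : R := d.+1%:R * 2.
have c1 : 1 <= c by have : (1 : R) <= d.+1%:R by [rewrite ler1n]; rewrite /c; lra.
pose E (p : nat * 'rV[int]_d) : set (borel_grassmannian R (leq_subr k d)) :=
  near_point (map_mx intr p.2) (c * 2 ^+ p.1).
pose wt (p : nat * 'rV[int]_d) := t ^+ p.1.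
pose f n :=
  weighted_events [seq (i, w) | w <- X n, i <- index_iota 0 (scale w)] wt E.
have mE p : measurable (E p) by exact: measurable_near_point.
have wt0 p : 0 <= wt p by rewrite exprn_ge0// ltW.
pose q1 : R := t * 2 ^+ k.
have q1E : q1 = 2 `^ (k%:R - alpha').
  by rewrite /q1 /t mulrC -powRN -powR_mulrn// powRD// pnatr_eq0 implybT.
have two_gt1 u : 0 < u -> 1 < (2 : R) `^ u.
  move=> u0; rewrite lt_neqAle eq_sym powR_eq1 !negb_or gt_eqF ?ltr1n//= -leNgt.
  by rewrite ler0n gt_eqF//= -[leLHS](powRr0 2) ler_powR ?ler1n// ltW.
have q1_gt1 : 1 < q1 by rewrite q1E two_gt1// subr_gt0.
pose q2 : R := 2 `^ alpha * t.
have q2_lt1 : q2 < 1.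
  rewrite /q2 /t -powRB ?pnatr_eq0 ?implybT// -opprB powRN invf_lt1 ?powR_gt0//.
  by rewrite two_gt1// subr_gt0.
have q20 : 0 <= q2 by rewrite mulr_ge0 ?powR_ge0 ?(ltW t0).
have [C1 C10 sum1] :=
  geometric_sum_le (le_trans ler01 (ltW q1_gt1)) (negbT (gt_eqF q1_gt1)).
have [C2 C20 sum2] := geometric_sum_le q20 (negbT (lt_eqF q2_lt1)).
have [C C0 near_le] := near_prob_scale hk hgamma.
have ck0 : 0 < C * c ^+ k by rewrite mulr_gt0// exprn_gt0//; lra.
pose K := C * c ^+ k * C1 * (B * 4 `^ alpha * C2).
have int_f n : (\int[gamma]_x (f n x)%:E <= K%:E)%E.
  rewrite integral_weighted_events// lee_fin big_allpairs_dep/=.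
  apply: le_trans (_ : \sum_(w <- X n) C * c ^+ k * C1 * t ^+ scale w <= _).
    apply: ler_sum => w _.
    apply: le_trans (_ : \sum_(i <- index_iota 0 (scale w))
        C * c ^+ k * (2 ^+ k)^-1 ^+ scale w * q1 ^+ i <= _).
      apply: ler_sum => i _; rewrite /wt/=.
      have -> : q1 ^+ i = t ^+ i * (2 ^+ k) ^+ i by rewrite exprMn.
      rewrite mulrCA ler_pM2l ?exprn_gt0//.
      apply: le_trans (near_le _ _ w _ _) _.
      - by rewrite mulr_ege1// exprn_ege1// ler1n.
      - by move=> j; rewrite mxE subrr normr0.
      have -> : (c * 2 ^+ i) ^+ k = c ^+ k * (2 ^+ k) ^+ i by rewrite exprMn exprAC.
      by rewrite -!mulrA [_ ^+ i * _]mulrC.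
    rewrite -mulr_sumr big_mkord.
    rewrite -[leLHS]mulrA -[leRHS]mulrA ler_pM2l//.
    have q1J : (2 ^+ k)^-1 ^+ scale w * q1 ^+ scale w = t ^+ scale w.
      by rewrite -exprMn /q1 mulrC mulfK// gt_eqF// exprn_gt0.
    rewrite -q1J mulrCA ler_pM2l ?exprn_gt0 ?invr_gt0 ?exprn_gt0//.
    by apply: le_trans (sum1 _) _; rewrite max_r// ltW.
  rewrite -mulr_sumr ler_pM2l; last by rewrite mulr_gt0.
  apply: le_trans (_ : B * 4 `^ alpha * \sum_(i < n) q2 ^+ i <= _).
    apply: dyadic_sum => [|i|w]; first exact: ltW.
      apply: le_trans (count_scale_le i AB (uX n) (XA n)).
      by rewrite ler_nat; apply: sub_count => w /= /eqP ->.
    by rewrite mem_filter => /andP[].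
  rewrite ler_pM2l ?mulr_gt0 ?powR_gt0//; apply: le_trans (sum2 n) _.
  by rewrite max_l ?(ltW q2_lt1)// expr1n mulr1.
have mf n : measurable_fun setT (f n) by exact: measurable_weighted_events.
have f0 n x : 0 <= f n x by exact: weighted_events_ge0.
have := ae_bounded_infinitely_often mf f0 int_f.
apply: filterS => V [M fM] P projP kerP.
have [Kp Kp0 Pbound] := endo_bounded P.
have [x xP] := floor_section A P.
pose Kc := ceil_nat (Kp + 1).
pose D : R := (Kc.*2.+1 ^ d)%:R.
pose M' := Num.max M 0; have M'0 : 0 <= M' by rewrite le_max lexx orbT.
pose B' := (B * 4 `^ alpha + M') * D.
have P_floor v i : Defs.floor_set (P @` A) v ->
    `|P (x v - map_mx intr (map_mx Num.floor (x v))) ord0 i| <= Kp.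
  move=> _; rewrite -[leRHS]mulr1; apply: Pbound => j.
  have := floor_diff (x := x v) erefl j; rewrite !mxE => /andP[? ?].
  by rewrite ler_norml; apply/andP; split; lra.
have dyadic i : 1 + Kp <= 2 ^+ i ->
    (size (centered_points (P @` A) (2 ^+ i)))%:R <= B' * (2 `^ alpha') ^+ i.
  move=> Ki; set Y := centered_points _ _.
  have YA v : v \in Y -> Defs.floor_set (P @` A) v by move=> /mem_points[].
  pose omega v := map_mx Num.floor (x v) : 'rV[int]_d.
  have fibers : (size Y <= size (values omega Y) * Kc.*2.+1 ^ d)%N.
    apply: size_le_values => [|u v uY vY uv j]; first exact: uniq_points.
    have [_ /floor_diff/(_ j)/andP[? ?]] := xP u (YA u uY).
    have [_ /floor_diff/(_ j)/andP[? ?]] := xP v (YA v vY).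
    rewrite -(ler_int R) intr_norm rmorphB/= -pmulrn.
    have Kp1 : 0 <= Kp + 1 by rewrite addr_ge0.
    apply: le_trans (_ : Kp + 1 <= _); last by case/andP: (ceil_natP Kp1).
    have : `|P (x u - x v) ord0 j| <= Kp * 1.
      apply: Pbound => j'.
      have /andP[? ?] := floor_diff (x := x u) erefl j'.
      have /andP[? ?] := floor_diff (x := x v) (esym uv) j'.
      by rewrite !mxE ler_norml; apply/andP; split; lra.
    rewrite linearB/= !mxE mulr1 !ler_norml => /andP[? ?].
    by apply/andP; split; lra.
  apply: le_trans (_ : (size (values omega Y))%:R * D <= _).
    by rewrite -natrM ler_nat.
  rewrite /B' mulrAC ler_pM2r ?ltr0n ?expn_gt0//.
  set W := values omega Y.
  have uW : uniq W by exact: undup_uniq.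
  have WA w : w \in W -> Defs.floor_set A w.
    rewrite mem_undup => /mapP[v vY ->]; have [Ax _] := xP v (YA v vY).
    by exists (x v).
  rewrite -(count_predC (fun w => (scale w <= i)%N) W) natrD mulrDl.
  apply: lerD.
    apply: le_trans (count_scale_le i AB uW WA) _.
    rewrite ler_pM2l ?mulr_gt0 ?powR_gt0//.
    apply: lerXn2r; rewrite ?nnegrE ?powR_ge0//.
    by rewrite ler_powR ?ler1n// ltW.
  set W2 := [seq w <- W | predC (fun w => (scale w <= i)%N) w].
  have -> : count (predC (fun w => (scale w <= i)%N)) W = size W2.
    by rewrite size_filter.
  have [n Nn fnM] := fM (\max_(w <- W2) (scale w).+1)%N.
  suff : (size W2)%:R * t ^+ i <= M'.
    by rewrite /t exprVn ler_pdivrMr// exprn_gt0// powR_gt0.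
  apply: le_trans (_ : f n V <= _); last by rewrite le_max fnM.
  pose g (w : 'rV[int]_d) :=
    \sum_(j <- index_iota 0 (scale w)) wt (j, w) * \1_(E (j, w)) V.
  have -> : f n V = \sum_(w <- X n) g w.
    by rewrite /f /weighted_events big_allpairs_dep.
  have g0 w : 0 <= g w.
    by apply: sumr_ge0 => j _; rewrite mulr_ge0// indicE ler0n.
  apply: le_trans (_ : \sum_(w <- W2) g w <= _); last first.
    apply: ler_sum_uniq_sub => //; first exact: filter_uniq.
    move=> w wW2; rewrite mem_filter.
    have wn : (scale w < n)%N.
      by apply: leq_trans Nn; apply: (leq_bigmax_seq (F := fun w => (scale w).+1)).
    rewrite wn mem_centered_points_scale//; apply: WA.
    by move: wW2; rewrite mem_filter => /andP[].
  rewrite mulr_natl -iter_addr_0 -(count_predT W2) -big_const_seq.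
  rewrite big_seq [leRHS]big_seq; apply: ler_sum => w.
  rewrite mem_filter /= -ltnNge mem_undup => /andP[iw /mapP[v vY wv]].
  rewrite /g (bigD1_seq i) ?iota_uniq ?mem_index_iota//= -[leLHS]addr0.
  rewrite lerD//; last first.
    by apply: sumr_ge0 => j _; rewrite mulr_ge0// indicE ler0n.
  rewrite indicE mem_set ?mulr1// /E/= /c -mulrA.
  apply: projection_near_point projP kerP _ _.
    by rewrite mulr_gt0// exprn_gt0.
  move=> j; have [_ /floor_diff/(_ j)/andP[? ?]] := xP v (YA v vY).
  have := P_floor v j (YA v vY); rewrite -/(omega v) -wv linearB/= !mxE.
  have /mem_points[_ /(_ j)] := vY; rewrite !mxE => /andP[? ?].
  by rewrite !ler_norml => /andP[? ?]; apply/andP; split; lra.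
move=> alpha'' a'a''.
have B'0 : 0 < B'.
  rewrite mulr_gt0 ?ltr0n ?expn_gt0// ltr_pwDl// mulr_gt0// powR_gt0//.
apply: (mass_measure_eq0_of_le (L := 1 + Kp) B'0 a'a'') => l Kl l0.
have l1 : 1 <= l by lra.
pose i := (trunc_log 2 (Num.truncn l)).+1.
have tl : (0 < Num.truncn l)%N by rewrite truncn_gt0.
have li : l < 2 ^+ i.
  have := truncnS_gt l; move=> /lt_le_trans; apply.
  by rewrite -natrX ler_nat trunc_log_ltn.
have il : 2 ^+ i <= 2 * l.
  rewrite exprS ler_pM2l// -natrX -truncn_ge_nat ?(ltW l0)//.
  exact: trunc_logP.
apply: le_trans (_ : (size (centered_points (P @` A) (2 ^+ i)))%:R <= _).
  by rewrite ler_nat size_centered_points_mono// ltW.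
apply: le_trans (dyadic i _) _; first lra.
rewrite ler_pM2l// -powR_mulrn ?powR_ge0// -powRrM mulrC powRrM powR_mulrn//.
by apply: ge0_ler_powR; rewrite ?nnegrE ?exprn_ge0//; lra.
Qed.

End SparseSets.

(** * The mass dimension of almost every projection *)

Section MassDimension.
Variables (R : realType) (d k : nat) (hk : (k <= d)%N).
Variable gamma : probability (borel_grassmannian R (leq_subr k d)) R.
Hypothesis hgamma : orthogonal_invariant gamma.
Implicit Types (A : set 'rV[R]_d) (P : 'End('rV[R]_d)).

Lemma ae_projectionS (Q1 Q2 : 'End('rV[R]_d) -> Prop) :
  (forall P, projection_onto_coords k P -> Q1 P -> Q2 P) ->
  ae_projection gamma Q1 -> ae_projection gamma Q2.
Proof.
move=> Q12 [N [mN N0 NQ]]; exists N; split=> //; apply: subset_trans NQ => V /=.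
by apply: contra_not => Q1V P projP kerP; apply: Q12 => //; exact: Q1V.
Qed.

Lemma ae_projection_foralln (Q : nat -> 'End('rV[R]_d) -> Prop) :
  (forall n, ae_projection gamma (Q n)) ->
  ae_projection gamma (fun P => forall n, Q n P).
Proof.
move=> aeQ; have [N [mN N0 NQ]] := ae_foralln aeQ.
exists N; split=> //; apply: subset_trans NQ => V /=.
by apply: contra_not => QV P projP kerP n; exact: QV.
Qed.

Lemma ae_projectionI (Q1 Q2 : 'End('rV[R]_d) -> Prop) :
  ae_projection gamma Q1 -> ae_projection gamma Q2 ->
  ae_projection gamma (fun P => Q1 P /\ Q2 P).
Proof.
move=> ae1 ae2; have [N [mN N0 NQ]] := negligibleU ae1 ae2.
exists N; split=> //; apply: subset_trans NQ => V /= QV.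
apply: contrapT => /not_orP[/contrapT Q1V /contrapT Q2V].
by apply: QV => P projP kerP; split; [exact: Q1V|exact: Q2V].
Qed.

(** The image lies in a coordinate subspace of dimension k. *)
Lemma mass_dim_projection_le A P : projection_onto_coords k P ->
  mass_dim (P @` A) <= k%:R.
Proof.
move=> [_ rangeP]; apply/ler_addgt0Pr => e e0; apply: mass_dim_le.
  by rewrite addr_ge0// ltW.
apply: (@mass_measure_eq0_gt R d k); first by rewrite ltrDl.
move=> _ [x _ <-]; suff : range P (P x) by rewrite rangeP.
by exists x.
Qed.

Lemma ae_mass_dim_le A (e : R) : 0 < e ->
  ae_projection gamma (fun P => mass_dim (P @` A) <= Num.min k%:R (mass_dim A) + e).
Proof.
move=> e0; set D := mass_dim A; have D0 : 0 <= D by exact: mass_dim_ge0.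
have [kD|Dk] := leP k%:R D.
  apply: aeW => V P projP _; apply: le_trans (mass_dim_projection_le A projP) _.
  by rewrite lerDl ltW.
pose r := Num.min (e / 3) ((k%:R - D) / 3).
have r0 : 0 < r by rewrite lt_min !divr_gt0// subr_gt0.
have re : r <= e / 3 by rewrite ge_min lexx.
have rk : r <= (k%:R - D) / 3 by rewrite ge_min lexx orbT.
have mA : mass_measure (D + r) A = 0%E.
  by apply: mass_measure_eq0_gt_dim; rewrite ltrDl.
have Dr0 : 0 <= D + r by lra.
have Dr2 : D + r < D + 2 * r by lra.
have Drk : D + 2 * r < k%:R by lra.
apply: ae_projectionS (ae_mass_measure_eq0 hk hgamma Dr0 Dr2 Drk mA) => P _ Peq0.
apply: le_trans (_ : D + 3 * r <= _); last lra.
by apply: mass_dim_le; [lra|apply: Peq0; lra].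
Qed.

Lemma ae_mass_dim_ge A (e : R) : 0 < e -> counting_dim A = mass_dim A ->
  ae_projection gamma (fun P => Num.min k%:R (mass_dim A) - e <= mass_dim (P @` A)).
Proof.
move=> e0 hA; set D := mass_dim A; have D0 : 0 <= D by exact: mass_dim_ge0.
have trivial (u : R) : u <= 0 ->
    ae_projection gamma (fun P => u <= mass_dim (P @` A)).
  by move=> u0; apply: aeW => V P _ _; apply: le_trans u0 (mass_dim_ge0 _).
have [De|eD] := leP D (e / 2).
  by apply: trivial; rewrite subr_le0 ge_min; apply/orP; right; lra.
(* A small r for which D + r is not the critical exponent k. *)
pose r := if D + e / 2 == k%:R then e / 4 else e / 2.
have rk : D + r != k%:R.
  by rewrite /r; case: (eqVneq (D + e / 2) k%:R) => [<-|//]; apply/eqP; lra.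
have re : 0 < r <= e / 2 by rewrite /r; case: ifP => _; lra.
have /andP[r0 re2] := re.
have [B B0 AB] : exists2 B, 0 < B & forall a s, 1 <= s ->
    (size (points A a s))%:R <= B * s `^ (D + r).
  by apply: counting_dim_bound; rewrite hA ltrDl.
have Dr0 : 0 <= D + r by lra.
have mA : (0 < mass_measure (D - r)%R A)%E by apply: mass_measure_gt0_lt_dim; lra.
apply: ae_projectionS (ae_mass_measure_gt0 hk hgamma Dr0 rk B0 AB mA) => P _ Pgt0.
apply: le_trans (le_mass_dim Pgt0).
by rewrite /Num.min /Num.max; case: ifP; case: ifP; lra.
Qed.

End MassDimension.

Theorem theoremD (R : realType) (d k : nat) (hk : (k <= d)%N)
    (gamma : probability (borel_grassmannian R (leq_subr k d)) R)
    (hgamma : orthogonal_invariant gamma)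
    (A : set 'rV[R]_d) (hA : counting_dim A = mass_dim A) :
  ae_projection gamma (fun P : 'End('rV[R]_d) =>
    mass_dim (P @` A) = Num.min k%:R (mass_dim A)) /\
  (counting_regular A -> mass_regular A -> mass_dim A <> k%:R ->
   ae_projection gamma (fun P : 'End('rV[R]_d) =>
     (0 < mass_measure (Num.min k%:R (mass_dim A)) (P @` A))%E)).
Proof.
split.
  have n0 n : 0 < n.+1%:R^-1 :> R by rewrite invr_gt0.
  have le_n := ae_projection_foralln (fun n => ae_mass_dim_le hk hgamma A (n0 n)).
  have ge_n := ae_projection_foralln (fun n => ae_mass_dim_ge hk hgamma (n0 n) hA).
  apply: ae_projectionS (ae_projectionI le_n ge_n) => P _ [leP geP].
  have small (u v : R) : (forall n, u <= v + n.+1%:R^-1) -> u <= v.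
    move=> uv; apply/ler_addgt0Pr => e e0.
    have [n ne] := ltr_add_invr e0.
    by apply: le_trans (uv n) _; rewrite lerD2l -[leLHS]add0r ltW.
  apply/eqP; rewrite eq_le; apply/andP; split; apply: small => n.
    exact: leP.
  by rewrite -lerBlDr; exact: geP.
move=> /andP[_ creg] /andP[mreg _] /eqP Dk.
have [B B0 AB] := counting_measure_bound (counting_dim_ge0 A) creg.
rewrite hA in AB; have D0 := mass_dim_ge0 A.
apply: ae_projectionS (ae_mass_measure_gt0 hk hgamma D0 Dk B0 AB mreg) => P _.
suff -> : mass_dim A - Num.max 0 (mass_dim A - k%:R) =
    Num.min k%:R (mass_dim A) by [].
by rewrite /Num.min /Num.max; case: ifP; case: ifP; lra.
Qed.
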